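(* For a pointed finitely complete category $\mathbb{C}$ the following are equivalent: (a) $\mathbb{C}$ has generic split extensions and admits normalizers; (b) the category $\mathbb{C}^{\mathbf{2}}$ has generic split extensions; (c) the functor $K:\mathbf{SplExt}(\mathbb{C})\to\mathbb{C}$ is a prefibration.
   Context: Let $\mathbb{C}$ be a pointed category. A split extension in $\mathbb{C}$ (of $B$ with kernel $X$) is a diagram $X\xrightarrow{\kappa}A\overset{\alpha}{\underset{\beta}{\rightleftarrows}}B$ with $\alpha:A\to B$, $\beta:B\to A$, where $\kappa$ is the kernel of $\alpha$ and $\alpha\beta=1_B$. A morphism of split extensions from $(X,A,B,\kappa,\alpha,\beta)$ to $(X',A',B',\kappa',\alpha',\beta')$ is a triple $u:X\to X'$, $v:A\to A'$, $w:B\to B'$ with $v\kappa=\kappa'u$, $v\beta=\beta'w$ and $w\alpha=\alpha'v$. $\mathbf{SplExt}(\mathbb{C})$ is the category of split extensions, and $K:\mathbf{SplExt}(\mathbb{C})\to\mathbb{C}$ sends a split extension $(X,A,B,\kappa,\alpha,\beta)$ to its kernel object $X$ (and a morphism $(u,v,w)$ to $u$). For an object $X$, the fiber $K^{-1}(X)$ consists of split extensions with kernel object $X$ and morphisms with $u=1_X$; a generic split extension with kernel $X$ is a terminal object of $K^{-1}(X)$. A category has generic split extensions if each of its objects is the kernel of a generic split extension. $\mathbb{C}^{\mathbf{2}}$ is the category of morphisms of $\mathbb{C}$. A functor $F:\mathbb{A}\to\mathbb{X}$ is a prefibration if for each $B$ in $\mathbb{A}$ and each $f:X\to F(B)$ there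 is $\varphi:A\to B$ with $F(\varphi)=f$ which is $F$-precartesian: for each $\psi:A'\to B$ with $F(\psi)=F(\varphi)$ there is a unique $\chi:A'\to A$ with $F(\chi)=1_X$ and $\varphi\chi=\psi$. Normalizers (in the sense of Bourn and Gray, in the pointed finitely complete case): for a monomorphism $f:X'\to X$, consider data consisting of morphisms $n:X'\to N$, $m:N\to X$ with $mn=f$, an equivalence relation $r_1,r_2:R\to N$ on $N$, and a morphism $\kappa:X'\to R$ such that the square $\langle r_1,r_2\rangle\kappa=\langle 0,1\rangle n$ is a pullback, where $\langle r_1,r_2\rangle:R\to N\times N$ and $\langle 0,1\rangle:N\to N\times N$. A normalizer of $f$ is such data that is universal: for any other such data $(N',m',n',R',r_1',r_2',\kappa')$ there is a unique pair of morphisms $h:N'\to N$, $v:R'\to R$ with $mh=m'$, $hn'=n$, $v\kappa'=\kappa$ and $\langle r_1,r_2\rangle v=(h\times h)\langle r_1',r_2'\rangle$. $\mathbb{C}$ admits normalizers if each monomorphism has a normalizer. *)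

(* Defs.v *)
From Stdlib Require Import List FinFun ProofIrrelevance RelationClasses.

Set Implicit Arguments.
Unset Strict Implicit.

Record Category := {
  Ob :> Type;
  Hom : Ob -> Ob -> Type;
  id : forall A, Hom A A;
  comp : forall A B C, Hom B C -> Hom A B -> Hom A C;
  comp_id_l : forall A B (f : Hom A B), comp (id B) f = f;
  comp_id_r : forall A B (f : Hom A B), comp f (id A) = f;
  comp_assoc : forall A B C D (h : Hom C D) (g : Hom B C) (f : Hom A B),
    comp h (comp g f) = comp (comp h g) f
}.

Arguments Hom {c} A B.
Arguments id {c} A.
Arguments comp {c A B C} g f.

Declare Scope cat_scope.
Delimit Scope cat_scope with cat.
Notation "g ∘ f" := (comp g f) (at level 40, left associativity) : cat_scope.
Local Open Scope cat_scope.

Record Functor (C D : Category) := {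
  fobj :> C -> D;
  fmap : forall A B : C, Hom A B -> Hom (fobj A) (fobj B);
  fmap_id : forall A : C, fmap (id A) = id (fobj A);
  fmap_comp : forall (A B E : C) (g : Hom B E) (f : Hom A B),
    fmap (g ∘ f) = fmap g ∘ fmap f
}.

Arguments fmap {C D} _ {A B} _.

(* Fibers and cartesian liftings are strict: they refer to equality of objects.
   An equality of objects is used through the identity morphism it induces. *)
Definition idto (C : Category) (A B : C) (e : A = B) : Hom A B :=
  match e in _ = B' return Hom A B' with eq_refl => id A end.

Definition is_mono (C : Category) (A B : C) (f : Hom A B) : Prop :=
  forall (Z : C) (g h : Hom Z A), f ∘ g = f ∘ h -> g = h.

Definition is_terminal (C : Category) (T : C) : Prop :=
  forall A : C, exists f : Hom A T, forall g : Hom A T, f = g.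

Definition is_pullback (C : Category) (A B D P : C)
    (f : Hom A D) (g : Hom B D) (p : Hom P A) (q : Hom P B) : Prop :=
  f ∘ p = g ∘ q /\
  forall (Z : C) (a : Hom Z A) (b : Hom Z B), f ∘ a = g ∘ b ->
    exists! k : Hom Z P, p ∘ k = a /\ q ∘ k = b.

Definition finite_category (J : Category) : Prop :=
  Finite J /\ forall i j : J, Finite (Hom i j).

Record Cone (J C : Category) (D : Functor J C) := {
  apex :> C;
  leg : forall j : J, Hom apex (D j);
  leg_natural : forall (i j : J) (a : Hom i j), fmap D a ∘ leg i = leg j
}.

Record Limit (J C : Category) (D : Functor J C) := {
  limit_cone :> Cone D;
  lift : forall c : Cone D, Hom c limit_cone;
  lift_leg : forall (c : Cone D) (j : J), leg limit_cone j ∘ lift c = leg c j;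
  lift_unique : forall (c : Cone D) (k : Hom c limit_cone),
    (forall j : J, leg limit_cone j ∘ k = leg c j) -> k = lift c
}.

(* Limits come with a choice, so that products and pairings are terms. *)
Definition FiniteLimits (C : Category) : Type :=
  forall J : Category, finite_category J -> forall D : Functor J C, Limit D.

Definition two_points : Category := {|
  Ob := bool;
  Hom := fun a b => a = b;
  id := fun a => eq_refl;
  comp := fun a b c g f => eq_trans f g;
  comp_id_l := fun a b f => proof_irrelevance _ _ _;
  comp_id_r := fun a b f => proof_irrelevance _ _ _;
  comp_assoc := fun a b c d h g f => proof_irrelevance _ _ _
|}.

Lemma two_points_finite : finite_category two_points.
Proof.
split.
- exists (true :: false :: nil); intros []; simpl; auto.
- intros i j; destruct (Bool.bool_dec i j) as [e | n].
  + exists (e :: nil); intros e'; left; exact (proof_irrelevance (i = j) e e').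
  + exists nil; intros e; destruct (n e).
Qed.

Section Products.
Variables (C : Category) (L : FiniteLimits C).

Definition pair_diagram (A B : C) : Functor two_points C.
Proof.
refine {| fobj := fun i : two_points => if i then A else B;
          fmap := fun i j e => idto (f_equal (fun b : bool => if b then A else B) e) |}.
- reflexivity.
- intros i j k g f; destruct g; destruct f; symmetry; apply comp_id_l.
Defined.

Definition product_limit (A B : C) : Limit (pair_diagram A B) :=
  L two_points_finite (pair_diagram A B).

Definition product (A B : C) : C := product_limit A B.

Definition proj1 (A B : C) : Hom (product A B) A := leg (product_limit A B) true.
Definition proj2 (A B : C) : Hom (product A B) B := leg (product_limit A B) false.

Definition pair_cone (A B Z : C) (f : Hom Z A) (g : Hom Z B) :
  Cone (pair_diagram A B).
Proof.
refine (@Build_Cone two_points C (pair_diagram A B) Z (fun i : two_points =>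
  if i as b return Hom Z (if b then A else B) then f else g) _).
intros i j e; destruct e; apply comp_id_l.
Defined.

Definition pairing (A B Z : C) (f : Hom Z A) (g : Hom Z B) : Hom Z (product A B) :=
  lift (product_limit A B) (pair_cone f g).

Definition product_map (A B A' B' : C) (f : Hom A A') (g : Hom B B') :
    Hom (product A B) (product A' B') :=
  pairing (f ∘ proj1 A B) (g ∘ proj2 A B).

End Products.

Record PointedCategory := {
  pcat :> Category;
  zero_obj : pcat;
  to_zero : forall A : pcat, Hom A zero_obj;
  from_zero : forall A : pcat, Hom zero_obj A;
  to_zero_unique : forall (A : pcat) (f : Hom A zero_obj), f = to_zero A;
  from_zero_unique : forall (A : pcat) (f : Hom zero_obj A), f = from_zero A
}.

Definition zero_mor (C : PointedCategory) (A B : C) : Hom A B :=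
  from_zero B ∘ to_zero A.

Definition is_kernel (C : PointedCategory) (X A B : C)
    (k : Hom X A) (a : Hom A B) : Prop :=
  a ∘ k = zero_mor X B /\
  forall (Z : C) (f : Hom Z A), a ∘ f = zero_mor Z B ->
    exists! g : Hom Z X, k ∘ g = f.

Section ArrowCategory.
Variable C : Category.

Record ArrOb := { src : C; tgt : C; arr : Hom src tgt }.

Record ArrHom (f g : ArrOb) := {
  asrc : Hom (src f) (src g);
  atgt : Hom (tgt f) (tgt g);
  arr_square : arr g ∘ asrc = atgt ∘ arr f
}.

Lemma arr_hom_ext (f g : ArrOb) (p q : ArrHom f g) :
  asrc p = asrc q -> atgt p = atgt q -> p = q.
Proof.
destruct p, q; simpl; intros; subst; f_equal; apply proof_irrelevance.
Qed.

Definition arr_id (f : ArrOb) : ArrHom f f.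
Proof.
refine {| asrc := id (src f); atgt := id (tgt f) |}.
rewrite comp_id_l, comp_id_r; reflexivity.
Defined.

Definition arr_comp (f g h : ArrOb) (q : ArrHom g h) (p : ArrHom f g) :
  ArrHom f h.
Proof.
refine {| asrc := asrc q ∘ asrc p; atgt := atgt q ∘ atgt p |}.
rewrite comp_assoc, arr_square, <- comp_assoc, arr_square, comp_assoc.
reflexivity.
Defined.

Definition Arrow : Category.
Proof.
refine {| Ob := ArrOb; Hom := ArrHom; id := arr_id; comp := arr_comp |};
  intros; apply arr_hom_ext; simpl;
  auto using comp_id_l, comp_id_r, comp_assoc.
Defined.

End ArrowCategory.

Section PointedArrowCategory.
Variable C : PointedCategory.

Definition arr_zero : Arrow C := Build_ArrOb (id (zero_obj C)).

Definition arr_to_zero (f : Arrow C) : Hom f arr_zero.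
Proof.
refine (@Build_ArrHom C f arr_zero (to_zero (src f)) (to_zero (tgt f)) _).
simpl; rewrite comp_id_l; symmetry; apply to_zero_unique.
Defined.

Definition arr_from_zero (f : Arrow C) : Hom arr_zero f.
Proof.
refine (@Build_ArrHom C arr_zero f (from_zero (src f)) (from_zero (tgt f)) _).
simpl; rewrite comp_id_r; apply from_zero_unique.
Defined.

Definition PointedArrow : PointedCategory.
Proof.
refine (@Build_PointedCategory (Arrow C) arr_zero arr_to_zero arr_from_zero _ _).
- intros f p; apply arr_hom_ext; apply to_zero_unique.
- intros f p; apply arr_hom_ext; apply from_zero_unique.
Defined.

End PointedArrowCategory.

Section SplitExtensions.
Variable C : PointedCategory.

Record SplitExtension := {
  ker : C;
  tot : C;
  base : C;
  kappa : Hom ker tot;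
  alpha : Hom tot base;
  beta : Hom base tot;
  kappa_kernel : is_kernel kappa alpha;
  alpha_beta : alpha ∘ beta = id base
}.

Record SplHom (E E' : SplitExtension) := {
  hker : Hom (ker E) (ker E');
  htot : Hom (tot E) (tot E');
  hbase : Hom (base E) (base E');
  hkappa : htot ∘ kappa E = kappa E' ∘ hker;
  hbeta : htot ∘ beta E = beta E' ∘ hbase;
  halpha : hbase ∘ alpha E = alpha E' ∘ htot
}.

Lemma spl_hom_ext (E E' : SplitExtension) (p q : SplHom E E') :
  hker p = hker q -> htot p = htot q -> hbase p = hbase q -> p = q.
Proof.
destruct p, q; simpl; intros; subst; f_equal; apply proof_irrelevance.
Qed.

Definition spl_id (E : SplitExtension) : SplHom E E.
Proof.
refine {| hker := id (ker E); htot := id (tot E); hbase := id (base E) |};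
  rewrite comp_id_l, comp_id_r; reflexivity.
Defined.

Definition spl_comp (E E' E'' : SplitExtension)
  (q : SplHom E' E'') (p : SplHom E E') : SplHom E E''.
Proof.
refine {| hker := hker q ∘ hker p; htot := htot q ∘ htot p;
          hbase := hbase q ∘ hbase p |}.
- rewrite <- comp_assoc, hkappa, comp_assoc, hkappa, <- comp_assoc; reflexivity.
- rewrite <- comp_assoc, hbeta, comp_assoc, hbeta, <- comp_assoc; reflexivity.
- rewrite <- comp_assoc, halpha, comp_assoc, halpha, <- comp_assoc; reflexivity.
Defined.

Definition SplExt : Category.
Proof.
refine {| Ob := SplitExtension; Hom := SplHom; id := spl_id; comp := spl_comp |};
  intros; apply spl_hom_ext; simpl;
  auto using comp_id_l, comp_id_r, comp_assoc.
Defined.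

Definition K : Functor SplExt C.
Proof.
refine {| fobj := ker : SplExt -> C; fmap := hker |}; reflexivity.
Defined.

End SplitExtensions.

Section Fibers.
Variables (A X : Category) (F : Functor A X).

Section Fiber.
Variable x : X.

Record FiberOb := { fib_ob :> A; fib_eq : F fib_ob = x }.

Record FiberHom (a b : FiberOb) := {
  fib_hom : Hom (fib_ob a) (fib_ob b);
  fib_hom_id : idto (fib_eq b) ∘ fmap F fib_hom = idto (fib_eq a)
}.

Lemma fiber_hom_ext (a b : FiberOb) (p q : FiberHom a b) :
  fib_hom p = fib_hom q -> p = q.
Proof.
destruct p, q; simpl; intros; subst; f_equal; apply proof_irrelevance.
Qed.

Definition fiber_id (a : FiberOb) : FiberHom a a.
Proof.
refine {| fib_hom := id (fib_ob a) |}.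
rewrite fmap_id; apply comp_id_r.
Defined.

Definition fiber_comp (a b c : FiberOb) (q : FiberHom b c) (p : FiberHom a b) :
  FiberHom a c.
Proof.
refine {| fib_hom := fib_hom q ∘ fib_hom p |}.
rewrite fmap_comp, comp_assoc, fib_hom_id; apply fib_hom_id.
Defined.

Definition Fiber : Category.
Proof.
refine {| Ob := FiberOb; Hom := FiberHom; id := fiber_id; comp := fiber_comp |};
  intros; apply fiber_hom_ext; simpl;
  auto using comp_id_l, comp_id_r, comp_assoc.
Defined.

End Fiber.

(* The equality e is part of the hypothesis F psi = F phi, which presupposes that
   the domains agree; idto e is then the identity of F a' = F a. *)
Definition is_precartesian (a b : A) (phi : Hom a b) : Prop :=
  forall (a' : A) (psi : Hom a' b) (e : F a' = F a),
    fmap F psi = fmap F phi ∘ idto e ->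
    exists! chi : Hom a' a, fmap F chi = idto e /\ phi ∘ chi = psi.

Definition is_prefibration : Prop :=
  forall (b : A) (x : X) (f : Hom x (F b)),
    exists (a : A) (e : F a = x) (phi : Hom a b),
      fmap F phi = f ∘ idto e /\ is_precartesian phi.

End Fibers.

Definition is_generic_split_extension (C : PointedCategory) (X : C)
    (E : Fiber (K C) X) : Prop :=
  is_terminal E.

Definition has_generic_split_extensions (C : PointedCategory) : Prop :=
  forall X : C, exists E : Fiber (K C) X, is_generic_split_extension E.

(* An internal equivalence relation, stated on generalized elements: each
   Hom Z R is an equivalence relation on Hom Z N. *)
Definition is_equivalence_relation (C : Category) (L : FiniteLimits C) (N R : C)
    (r1 r2 : Hom R N) : Prop :=
  is_mono (pairing L r1 r2) /\
  forall Z : C, Equivalence (fun a b : Hom Z N =>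
    exists x : Hom Z R, r1 ∘ x = a /\ r2 ∘ x = b).

Section Normalizers.
Variables (C : PointedCategory) (L : FiniteLimits C).

Record NormalizerData (X' X : C) (f : Hom X' X) := {
  nz_N : C;
  nz_R : C;
  nz_n : Hom X' nz_N;
  nz_m : Hom nz_N X;
  nz_r1 : Hom nz_R nz_N;
  nz_r2 : Hom nz_R nz_N;
  nz_kappa : Hom X' nz_R;
  nz_mn : nz_m ∘ nz_n = f;
  nz_equiv : is_equivalence_relation L nz_r1 nz_r2;
  nz_pullback : is_pullback (pairing L nz_r1 nz_r2)
    (pairing L (zero_mor nz_N nz_N) (id nz_N)) nz_kappa nz_n
}.

Definition is_normalizer (X' X : C) (f : Hom X' X) (D : NormalizerData f) : Prop :=
  forall D' : NormalizerData f,
    exists! hv : Hom (nz_N D') (nz_N D) * Hom (nz_R D') (nz_R D),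
      let (h, v) := hv in
      nz_m D ∘ h = nz_m D' /\
      h ∘ nz_n D' = nz_n D /\
      v ∘ nz_kappa D' = nz_kappa D /\
      pairing L (nz_r1 D) (nz_r2 D) ∘ v =
        product_map L h h ∘ pairing L (nz_r1 D') (nz_r2 D').

Definition admits_normalizers : Prop :=
  forall (X' X : C) (f : Hom X' X), is_mono f ->
    exists D : NormalizerData f, is_normalizer D.

End Normalizers.

(* Main.v *)
From Stdlib Require Import ProofIrrelevance List RelationClasses.
Require Import Defs.

(** The three conditions meet in (c), and most of the work is in relating
normalizers to precartesian liftings of K.

Conditions (b) and (c).  Kernels in the arrow category are computed
componentwise, so a split extension of arrows with kernel f : X' -> X is the
same thing as a morphism of split extensions over f ([arrow_generic_iff]).
Given (c), the lifting of f to a generic split extension E with kernel X is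
terminal among these: a morphism F' -> F over f extends uniquely along F -> E,
and then factors uniquely through the lifting.  Conversely, the codomain E0 of a
terminal morphism over f is generic, because X' itself, with base the zero
object, is the free split extension with kernel X' ([generic_arrow_generic]);
pulling the terminal morphism back along E -> E0 gives the precartesian lifting
of f to E ([spl_pullback]).

From (c) to normalizers.  Lift a monomorphism f to the split extension
X x X -> X whose section is the diagonal.  The result E, with base N, classifies
pairs of a split extension F with kernel X' and a morphism t from its total
object to X that restricts to f ([classifies]).  In the case of groups, E is the
semidirect product of X' with its normalizer N, and its elements are the pairs
of elements of N that are congruent modulo X'.  In general E is still a relation
on N: an element b of E has a source prj E b, and the base change of E along
that source, with b as its section, has a classifying morphism whose base
component is the target of b ([has_target]).  Uniqueness of classifying
morphisms gives all the laws.  Two elements with the same source give a third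
one between their targets ([has_target_euclidean]), which together with the
section makes the relation an equivalence.  Because f is a monomorphism, the
pairs of elements of E with the same source and the same image in X form again
a split extension with kernel X', so such elements are equal
([classifier_jointly_mono]), and the relation is jointly monic.  Universality
of the resulting normalizer is the universality of E, applied to equivalence
relations regarded as split extensions ([classifier_normalizer]).

From (a) to (c).  If f is a monomorphism and E is a split extension with kernel
X, take the normalizer N of the composite X' -> X -> total E; the lifting of f
has as base the part of N that is mapped into the section of E
([normalizer_universal_lift]).  An arbitrary f is replaced by its graph
X' -> X' x X and E by the product E0 x E, where E0 is generic with kernel X';
as each F has a unique morphism to E0 over the identity, the lifting of the
graph to E0 x E, followed by the projection to E, is a precartesian lifting of
f ([generic_normalizers_prefibration]). *)

Set Implicit Arguments.
Unset Strict Implicit.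
Local Open Scope cat_scope.

(** * Composition, zero morphisms and kernels *)

Lemma comp_rewrite (C : Category) (A B D : C) (g : Hom B D) (f : Hom A B)
    (k : Hom A D) (H : g ∘ f = k) (Z : C) (x : Hom Z A) :
  g ∘ (f ∘ x) = k ∘ x.
Proof. rewrite comp_assoc, H; reflexivity. Qed.

Ltac assoc := repeat rewrite <- comp_assoc.

(* Rewriting modulo associativity, on composites nested to the right. *)
Tactic Notation "crw" uconstr(H) :=
  assoc; first [rewrite H | rewrite (comp_rewrite H)]; assoc.

Section Zero.
Variable C : PointedCategory.

Lemma comp_zero_r (A B D : C) (f : Hom B D) :
  f ∘ zero_mor A B = zero_mor A D.
Proof.
unfold zero_mor; rewrite comp_assoc; f_equal; apply from_zero_unique.
Qed.

Lemma comp_zero_l (A B D : C) (f : Hom A B) :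
  zero_mor B D ∘ f = zero_mor A D.
Proof.
unfold zero_mor; rewrite <- comp_assoc; f_equal; apply to_zero_unique.
Qed.

Lemma kernel_mono (X A B : C) (k : Hom X A) (a : Hom A B) :
  is_kernel k a -> is_mono k.
Proof.
intros [ak0 univ] Z g h e.
destruct (univ Z (k ∘ g)) as [l [_ uniq]].
- rewrite comp_assoc, ak0; apply comp_zero_l.
- rewrite <- (uniq g eq_refl); apply uniq; symmetry; exact e.
Qed.

Lemma mono_comp (A B D : C) (g : Hom B D) (f : Hom A B) :
  is_mono g -> is_mono f -> is_mono (g ∘ f).
Proof.
intros mg mf Z h k e; apply mf, mg; rewrite !comp_assoc; exact e.
Qed.

Lemma kernel_factor (X A B : C) (k : Hom X A) (a : Hom A B) :
  is_kernel k a -> forall (Z : C) (f : Hom Z A), a ∘ f = zero_mor Z B ->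
  exists g : Hom Z X, k ∘ g = f.
Proof. intros [_ univ] Z f e; destruct (univ Z f e) as [g [e' _]]; eauto. Qed.

Lemma is_kernel_intro (X A B : C) (k : Hom X A) (a : Hom A B) :
  a ∘ k = zero_mor X B -> is_mono k ->
  (forall (Z : C) (f : Hom Z A), a ∘ f = zero_mor Z B ->
     exists g : Hom Z X, k ∘ g = f) ->
  is_kernel k a.
Proof.
intros e mk fac; split; [exact e |].
intros Z f ef; destruct (fac Z f ef) as [g eg]; exists g; split; [exact eg |].
intros g' eg'; apply mk; rewrite eg, eg'; reflexivity.
Qed.

End Zero.

(** * Products and pullbacks *)

Inductive cospan_ob := cospan_left | cospan_right | cospan_tip.

Definition cospan_hom (i j : cospan_ob) : Set :=
  match i, j with
  | cospan_left, cospan_left | cospan_right, cospan_right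
  | _, cospan_tip => unit
  | _, _ => Empty_set
  end.

Definition cospan : Category.
Proof.
refine (@Build_Category cospan_ob cospan_hom
  (fun i => match i with cospan_left | cospan_right | cospan_tip => tt end)
  (fun i j k => match i, j, k with
     | cospan_left, cospan_left, cospan_left
     | cospan_right, cospan_right, cospan_right
     | _, _, cospan_tip => fun _ _ => tt
     | _, cospan_tip, cospan_left | _, cospan_tip, cospan_right
     | _, cospan_left, cospan_right
     | _, cospan_right, cospan_left => fun g _ => match g with end
     | cospan_tip, cospan_left, cospan_left
     | cospan_tip, cospan_right, cospan_right
     | cospan_left, cospan_right, cospan_right
     | cospan_right, cospan_left, cospan_left =>
         fun _ f => match f with end
     end) _ _ _).
- intros [] [] []; reflexivity.
- intros [] [] []; reflexivity.
- intros [] [] [] [] [] [] []; reflexivity.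
Defined.

Lemma cospan_finite : finite_category cospan.
Proof.
split.
- exists (cospan_left :: cospan_right :: cospan_tip :: nil).
  intros []; simpl; auto.
- intros [] []; solve [exists (tt :: nil); intros []; simpl; auto
                      | exists nil; intros []].
Qed.

Section Limits.
Variables (C : Category) (L : FiniteLimits C).

Lemma proj1_pairing (A B Z : C) (f : Hom Z A) (g : Hom Z B) :
  proj1 L A B ∘ pairing L f g = f.
Proof. exact (lift_leg (product_limit L A B) (pair_cone f g) true). Qed.

Lemma proj2_pairing (A B Z : C) (f : Hom Z A) (g : Hom Z B) :
  proj2 L A B ∘ pairing L f g = g.
Proof. exact (lift_leg (product_limit L A B) (pair_cone f g) false). Qed.

Lemma product_ext (A B Z : C) (h k : Hom Z (product L A B)) :
  proj1 L A B ∘ h = proj1 L A B ∘ k -> proj2 L A B ∘ h = proj2 L A B ∘ k ->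
  h = k.
Proof.
intros e1 e2.
transitivity (pairing L (proj1 L A B ∘ k) (proj2 L A B ∘ k)).
- apply (@lift_unique _ _ _ (product_limit L A B) (pair_cone _ _) h).
  intros []; assumption.
- symmetry.
  apply (@lift_unique _ _ _ (product_limit L A B) (pair_cone _ _) k).
  intros []; reflexivity.
Qed.

Lemma pairing_comp (A B Z Y : C) (f : Hom Z A) (g : Hom Z B) (h : Hom Y Z) :
  pairing L f g ∘ h = pairing L (f ∘ h) (g ∘ h).
Proof.
apply product_ext; rewrite comp_assoc, ?proj1_pairing, ?proj2_pairing;
  reflexivity.
Qed.

Lemma pairing_inj (A B Z : C) (f f' : Hom Z A) (g g' : Hom Z B) :
  pairing L f g = pairing L f' g' -> f = f' /\ g = g'.
Proof.
intros e; split.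
- rewrite <- (proj1_pairing f g), e; apply proj1_pairing.
- rewrite <- (proj2_pairing f g), e; apply proj2_pairing.
Qed.

Lemma pairing_comp_inj (A B Z Y : C) (f : Hom Z A) (g : Hom Z B)
    (h k : Hom Y Z) :
  pairing L f g ∘ h = pairing L f g ∘ k -> f ∘ h = f ∘ k /\ g ∘ h = g ∘ k.
Proof. rewrite !pairing_comp; apply pairing_inj. Qed.

Lemma proj1_product_map (A B A' B' : C) (f : Hom A A') (g : Hom B B') :
  proj1 L A' B' ∘ product_map L f g = f ∘ proj1 L A B.
Proof. apply proj1_pairing. Qed.

Lemma proj2_product_map (A B A' B' : C) (f : Hom A A') (g : Hom B B') :
  proj2 L A' B' ∘ product_map L f g = g ∘ proj2 L A B.
Proof. apply proj2_pairing. Qed.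

Section Pullback.
Variables (A B D : C) (f : Hom A D) (g : Hom B D).

Definition cospan_diagram : Functor cospan C.
Proof.
refine (@Build_Functor cospan C
  (fun i => match i with
     | cospan_left => A | cospan_right => B | cospan_tip => D end)
  (fun i j => match i, j with
     | cospan_left, cospan_left => fun _ => id A
     | cospan_right, cospan_right => fun _ => id B
     | cospan_tip, cospan_tip => fun _ => id D
     | cospan_left, cospan_tip => fun _ => f
     | cospan_right, cospan_tip => fun _ => g
     | cospan_left, cospan_right | cospan_right, cospan_left
     | cospan_tip, cospan_left | cospan_tip, cospan_right =>
         fun a => match a with end
     end) _ _).
- intros []; reflexivity.
- intros [] [] [] [] []; simpl; rewrite ?comp_id_l, ?comp_id_r; reflexivity.
Defined.

Definition pullback_limit : Limit cospan_diagram :=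
  L cospan_finite cospan_diagram.

Definition pullback : C := pullback_limit.

Definition pb1 : Hom pullback A := leg pullback_limit cospan_left.
Definition pb2 : Hom pullback B := leg pullback_limit cospan_right.

Lemma pb_square : f ∘ pb1 = g ∘ pb2.
Proof.
transitivity (leg pullback_limit cospan_tip).
- exact (@leg_natural _ _ _ pullback_limit cospan_left cospan_tip tt).
- symmetry.
  exact (@leg_natural _ _ _ pullback_limit cospan_right cospan_tip tt).
Qed.

Definition cospan_cone (Z : C) (a : Hom Z A) (b : Hom Z B)
    (e : f ∘ a = g ∘ b) : Cone cospan_diagram.
Proof.
refine (@Build_Cone cospan C cospan_diagram Z (fun i => match i with
  | cospan_left => a | cospan_right => b | cospan_tip => f ∘ a end) _).
intros [] [] []; simpl; rewrite ?comp_id_l; congruence.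
Defined.

Definition pb_pair (Z : C) (a : Hom Z A) (b : Hom Z B) (e : f ∘ a = g ∘ b) :
  Hom Z pullback := lift pullback_limit (cospan_cone e).

Lemma pb1_pair (Z : C) (a : Hom Z A) (b : Hom Z B) (e : f ∘ a = g ∘ b) :
  pb1 ∘ pb_pair e = a.
Proof. exact (lift_leg pullback_limit (cospan_cone e) cospan_left). Qed.

Lemma pb2_pair (Z : C) (a : Hom Z A) (b : Hom Z B) (e : f ∘ a = g ∘ b) :
  pb2 ∘ pb_pair e = b.
Proof. exact (lift_leg pullback_limit (cospan_cone e) cospan_right). Qed.

Lemma pb_ext (Z : C) (h k : Hom Z pullback) :
  pb1 ∘ h = pb1 ∘ k -> pb2 ∘ h = pb2 ∘ k -> h = k.
Proof.
intros e1 e2.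
assert (e : f ∘ (pb1 ∘ k) = g ∘ (pb2 ∘ k)).
{ rewrite !comp_assoc, pb_square; reflexivity. }
assert (tip : leg pullback_limit cospan_tip = f ∘ pb1).
{ symmetry.
  exact (@leg_natural _ _ _ pullback_limit cospan_left cospan_tip tt). }
transitivity (pb_pair e).
- apply (@lift_unique _ _ _ pullback_limit (cospan_cone e) h).
  intros []; simpl; [exact e1 | exact e2 |].
  rewrite tip, <- comp_assoc, e1; reflexivity.
- symmetry; apply (@lift_unique _ _ _ pullback_limit (cospan_cone e) k).
  intros []; simpl; try reflexivity.
  rewrite tip; symmetry; apply comp_assoc.
Qed.

End Pullback.
End Limits.

(** * Split extensions with a prescribed kernel object *)

Section StrictExtensions.
Variable C : PointedCategory.

(** The kernel object is a parameter here and not a field, so that a morphism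
between extensions with the same kernel can be compared with an identity
morphism without transport along an equality of objects. *)
Record SplExtOn (X : C) := {
  total : C;
  basis : C;
  inj : Hom X total;
  prj : Hom total basis;
  sec : Hom basis total;
  inj_kernel : is_kernel inj prj;
  prj_sec : prj ∘ sec = id basis
}.

Definition spl (X : C) (E : SplExtOn X) : SplExt C :=
  Build_SplitExtension (inj_kernel E) (prj_sec E).

Lemma prj_inj (X : C) (E : SplExtOn X) :
  prj E ∘ inj E = zero_mor X (basis E).
Proof. apply inj_kernel. Qed.

Definition spl_hom (X Y : C) (E : SplExtOn X) (F : SplExtOn Y) (u : Hom X Y)
    (v : Hom (total E) (total F)) (w : Hom (basis E) (basis F))
    (ei : v ∘ inj E = inj F ∘ u) (es : v ∘ sec E = sec F ∘ w)
    (ep : w ∘ prj E = prj F ∘ v) : Hom (spl E) (spl F) :=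
  @Build_SplHom C (spl E) (spl F) u v w ei es ep.

Definition strict_fiber (X : C) (E : SplExtOn X) : Fiber (K C) X :=
  @Build_FiberOb _ _ (K C) X (spl E) eq_refl.

(** The equality of objects carried by an object of the fiber can be eliminated
because the kernel object is a field of the split extension. *)
Lemma fiber_strict (X : C) (a : Fiber (K C) X) :
  exists E : SplExtOn X, a = strict_fiber E.
Proof.
destruct a as [[Y A B k p s ker_k ps] e]; simpl in e; destruct e.
exists (Build_SplExtOn ker_k ps); reflexivity.
Qed.

Definition is_generic (X : C) (E : SplExtOn X) : Prop :=
  forall F : SplExtOn X, exists c : Hom (spl F) (spl E),
    hker c = id X /\
    forall c' : Hom (spl F) (spl E), hker c' = id X -> c' = c.

Lemma generic_iff :
  has_generic_split_extensions C <->
  forall X : C, exists E : SplExtOn X, is_generic E.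
Proof.
split; intros H X; destruct (H X) as [E gen].
- destruct (fiber_strict E) as [E' ->]; exists E'; intros F.
  destruct (gen (strict_fiber F)) as [[c ec] uniq]; simpl in *.
  exists c; split.
  + rewrite <- ec; symmetry; apply comp_id_l.
  + intros c' ec'.
    assert (e : id X ∘ hker c' = id X) by (rewrite ec'; apply comp_id_l).
    exact (f_equal (@fib_hom _ _ _ _ _ _)
      (eq_sym (uniq (@Build_FiberHom _ _ (K C) X (strict_fiber F)
                       (strict_fiber E') c' e)))).
- exists (strict_fiber E); intros a.
  destruct (fiber_strict a) as [F ->]; destruct (gen F) as [c [ec uniq]].
  assert (e : id X ∘ hker c = id X) by (rewrite ec; apply comp_id_l).
  exists (@Build_FiberHom _ _ (K C) X (strict_fiber F) (strict_fiber E) c e).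
  intros [c' ec']; apply fiber_hom_ext; simpl in *.
  symmetry; apply uniq; rewrite <- ec'; symmetry; apply comp_id_l.
Qed.

(** Precartesian morphisms, with equality of the kernel objects built into the
types of the extensions. *)
Definition is_universal (X' X : C) (E' : SplExtOn X') (E : SplExtOn X)
    (f : Hom (spl E') (spl E)) : Prop :=
  forall (F : SplExtOn X') (g : Hom (spl F) (spl E)), hker g = hker f ->
  exists c : Hom (spl F) (spl E'), (hker c = id X' /\ f ∘ c = g) /\
    forall c' : Hom (spl F) (spl E'), hker c' = id X' -> f ∘ c' = g -> c' = c.

Lemma prefibration_iff :
  is_prefibration (K C) <->
  forall (X' X : C) (f : Hom X' X) (E : SplExtOn X),
  exists (E' : SplExtOn X') (phi : Hom (spl E') (spl E)),
    hker phi = f /\ is_universal phi.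
Proof.
split.
- intros H X' X f E; destruct (H (spl E) X' f) as [a [e [phi [ef pre]]]].
  destruct a as [Y A B k p s ker_k ps]; simpl in e; destruct e.
  exists (Build_SplExtOn ker_k ps), phi; split.
  + rewrite <- (comp_id_r f); exact ef.
  + intros F g eg; destruct (pre (spl F) g eq_refl) as [c [[ec1 ec2] uniq]].
    { simpl; rewrite comp_id_r; exact eg. }
    exists c; split; [split; [exact ec1 | exact ec2] |].
    intros c' e1 e2; symmetry; apply uniq; split; [exact e1 | exact e2].
- intros H E X' f; destruct E as [X A B k p s ker_k ps].
  destruct (H X' X f (Build_SplExtOn ker_k ps)) as [E' [phi [ef univ]]].
  exists (spl E'), eq_refl, phi; split.
  + simpl; rewrite comp_id_r; exact ef.
  + intros F g e eg; destruct F as [Y A' B' k' p' s' ker_k' ps'].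
    simpl in e; destruct e.
    destruct (univ (Build_SplExtOn ker_k' ps') g) as [c [ec uniq]].
    { rewrite <- (comp_id_r (hker phi)); exact eg. }
    exists c; split; [exact ec |].
    intros c' [e1 e2]; symmetry; apply uniq; assumption.
Qed.

End StrictExtensions.

(** * Split extensions in the category of arrows *)

Section ArrowExtensions.
Variable C : PointedCategory.

Lemma kernel_arrow (X' A' B' X A B : C) (k' : Hom X' A') (p' : Hom A' B')
    (k : Hom X A) (p : Hom A B) (f : Hom X' X) (v : Hom A' A) (w : Hom B' B)
    (ek : v ∘ k' = k ∘ f) (ep : w ∘ p' = p ∘ v) :
  is_kernel k' p' -> is_kernel k p ->
  @is_kernel (PointedArrow C) (Build_ArrOb f) (Build_ArrOb v) (Build_ArrOb w)
    (@Build_ArrHom C (Build_ArrOb f) (Build_ArrOb v) k' k ek)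
    (@Build_ArrHom C (Build_ArrOb v) (Build_ArrOb w) p' p ep).
Proof.
intros ker' ker; apply is_kernel_intro.
- apply arr_hom_ext; simpl; [apply ker' | apply ker].
- intros Z g h e; apply arr_hom_ext.
  + exact (kernel_mono ker' (f_equal (@asrc _ _ _) e)).
  + exact (kernel_mono ker (f_equal (@atgt _ _ _) e)).
- intros Z [g1 g2 eg] e; simpl in *.
  destruct (kernel_factor ker' (f_equal (@asrc _ _ _) e)) as [l1 e1].
  destruct (kernel_factor ker (f_equal (@atgt _ _ _) e)) as [l2 e2].
  simpl in *.
  assert (el : f ∘ l1 = l2 ∘ arr Z).
  { apply (kernel_mono ker); rewrite !comp_assoc, <- ek, e2, <- eg.
    crw e1; reflexivity. }
  exists (@Build_ArrHom C Z (Build_ArrOb f) l1 l2 el).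
  apply arr_hom_ext; simpl; assumption.
Qed.

(** The domain and codomain functors preserve kernels because each has a left
adjoint: Z goes to its identity for the domain, and to the morphism from the
zero object to Z for the codomain.  Testing the kernel of arrows on these
objects gives the two kernels. *)
Lemma kernel_of_arrow (X A B : Arrow C) (k : ArrHom X A) (p : ArrHom A B) :
  @is_kernel (PointedArrow C) X A B k p ->
  is_kernel (asrc k) (asrc p) /\ is_kernel (atgt k) (atgt p).
Proof.
intros ker; pose proof (kernel_mono ker) as mk.
destruct ker as [e univ]; pose proof (kernel_factor (conj e univ)) as fac.
clear univ; split.
- assert (ids : forall (Z : C) (Y : Arrow C) (g : Hom Z (src Y)),
    exists h : ArrHom (Build_ArrOb (id Z)) Y,
      asrc h = g /\ atgt h = arr Y ∘ g).
  { intros Z Y g; unshelve eexists.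
    - refine (@Build_ArrHom C (Build_ArrOb (id Z)) Y g (arr Y ∘ g) _).
      simpl; symmetry; apply comp_id_r.
    - split; reflexivity. }
  apply is_kernel_intro.
  + exact (f_equal (@asrc _ _ _) e).
  + intros Z g h eg; destruct (ids Z X g) as [g' [<- eg2]].
    destruct (ids Z X h) as [h' [<- eh2]].
    f_equal; apply (mk (Build_ArrOb (id Z))), arr_hom_ext; [exact eg |].
    simpl; rewrite eg2, eh2, !comp_assoc, <- (arr_square k).
    crw eg; reflexivity.
  + intros Z g eg; destruct (ids Z A g) as [g' [eg1 eg2]].
    destruct (fac (Build_ArrOb (id Z)) g') as [l el].
    * apply arr_hom_ext; simpl; [rewrite eg1; exact eg |].
      rewrite eg2, comp_assoc, <- (arr_square p); crw eg.
      rewrite comp_zero_r; reflexivity.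
    * exists (asrc l); rewrite <- eg1, <- el; reflexivity.
- assert (zeros : forall (Z : C) (Y : Arrow C) (g : Hom Z (tgt Y)),
    exists h : ArrHom (Build_ArrOb (from_zero Z)) Y,
      asrc h = from_zero _ /\ atgt h = g).
  { intros Z Y g; unshelve eexists.
    - refine (@Build_ArrHom C (Build_ArrOb (from_zero Z)) Y
        (from_zero _) g _).
      simpl; rewrite !(from_zero_unique (_ ∘ _)); reflexivity.
    - split; reflexivity. }
  apply is_kernel_intro.
  + exact (f_equal (@atgt _ _ _) e).
  + intros Z g h eg; destruct (zeros Z X g) as [g' [eg1 <-]].
    destruct (zeros Z X h) as [h' [eh1 <-]].
    f_equal; apply (mk (Build_ArrOb (from_zero Z))), arr_hom_ext; [| exact eg].
    simpl; rewrite eg1, eh1; reflexivity.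
  + intros Z g eg; destruct (zeros Z A g) as [g' [eg1 eg2]].
    destruct (fac (Build_ArrOb (from_zero Z)) g') as [l el].
    * apply arr_hom_ext; simpl; [| rewrite eg2; exact eg].
      transitivity (from_zero (src B)); [| symmetry]; apply from_zero_unique.
    * exists (atgt l); rewrite <- eg2, <- el; reflexivity.
Qed.

(** A morphism of split extensions over f, seen as a split extension of arrows
with kernel f.  The kernel component is the variable f, up to an equation, so
that the kernel is the given arrow on the nose. *)
Definition arrow_ext (X' X : C) (f : Hom X' X) (E' : SplExtOn X')
    (E : SplExtOn X) (phi : Hom (spl E') (spl E)) (e : hker phi = f) :
  @SplExtOn (PointedArrow C) (Build_ArrOb f).
Proof.
assert (ek : htot phi ∘ inj E' = inj E ∘ f).
{ rewrite <- e; exact (hkappa phi). }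
refine (@Build_SplExtOn (PointedArrow C) (Build_ArrOb f)
  (Build_ArrOb (htot phi)) (Build_ArrOb (hbase phi)) _ _
  (@Build_ArrHom C (Build_ArrOb (hbase phi)) (Build_ArrOb (htot phi))
     (sec E') (sec E) (hbeta phi))
  (kernel_arrow ek (halpha phi) (inj_kernel E') (inj_kernel E)) _).
apply arr_hom_ext; apply prj_sec.
Defined.

Lemma strict_ext_eq (D : PointedCategory) (X A B : D) (k k' : Hom X A)
    (p p' : Hom A B) (s s' : Hom B A) (ker : is_kernel k p)
    (ker' : is_kernel k' p') (ps : p ∘ s = id B) (ps' : p' ∘ s' = id B) :
  k = k' -> p = p' -> s = s' -> Build_SplExtOn ker ps = Build_SplExtOn ker' ps'.
Proof. intros -> -> ->; f_equal; apply proof_irrelevance. Qed.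

Lemma arrow_ext_surjective (X' X : C) (f : Hom X' X)
    (G : @SplExtOn (PointedArrow C) (Build_ArrOb f)) :
  exists (E' : SplExtOn X') (E : SplExtOn X) (phi : Hom (spl E') (spl E))
    (e : hker phi = f), G = arrow_ext e.
Proof.
destruct G as [[A' A v] [B' B w] k p s ker ps].
destruct (kernel_of_arrow ker) as [ker1 ker2].
pose proof (f_equal (@asrc _ _ _) ps : asrc p ∘ asrc s = id B') as ps1.
pose proof (f_equal (@atgt _ _ _) ps : atgt p ∘ atgt s = id B) as ps2.
exists (Build_SplExtOn ker1 ps1), (Build_SplExtOn ker2 ps2).
exists (@spl_hom C X' X (Build_SplExtOn ker1 ps1) (Build_SplExtOn ker2 ps2)
  f v w (arr_square k) (arr_square s) (arr_square p)), eq_refl.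
apply strict_ext_eq; apply arr_hom_ext; reflexivity.
Qed.

Definition arrow_hom (X' X : C) (f : Hom X' X) (F' E' : SplExtOn X')
    (F E : SplExtOn X) (psi : Hom (spl F') (spl F))
    (phi : Hom (spl E') (spl E)) (epsi : hker psi = f) (ephi : hker phi = f)
    (a : Hom (spl F') (spl E')) (b : Hom (spl F) (spl E))
    (e : phi ∘ a = b ∘ psi) :
  Hom (spl (arrow_ext epsi)) (spl (arrow_ext ephi)).
Proof.
assert (ek : f ∘ hker a = hker b ∘ f).
{ generalize (f_equal (@hker _ _ _) e); simpl; congruence. }
refine (@spl_hom (PointedArrow C) (Build_ArrOb f) (Build_ArrOb f)
  (arrow_ext epsi) (arrow_ext ephi)
  (@Build_ArrHom C (Build_ArrOb f) (Build_ArrOb f) (hker a) (hker b) ek)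
  (@Build_ArrHom C (Build_ArrOb (htot psi)) (Build_ArrOb (htot phi))
     (htot a) (htot b) (f_equal (@htot _ _ _) e))
  (@Build_ArrHom C (Build_ArrOb (hbase psi)) (Build_ArrOb (hbase phi))
     (hbase a) (hbase b) (f_equal (@hbase _ _ _) e)) _ _ _);
  apply arr_hom_ext;
  first [exact (hkappa a) | exact (hkappa b) | exact (hbeta a)
        | exact (hbeta b) | exact (halpha a) | exact (halpha b)].
Defined.

Lemma arrow_hom_surjective (X' X : C) (f : Hom X' X) (F' E' : SplExtOn X')
    (F E : SplExtOn X) (psi : Hom (spl F') (spl F))
    (phi : Hom (spl E') (spl E)) (epsi : hker psi = f) (ephi : hker phi = f)
    (c : Hom (spl (arrow_ext epsi)) (spl (arrow_ext ephi))) :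
  exists (a : Hom (spl F') (spl E')) (b : Hom (spl F) (spl E))
    (e : phi ∘ a = b ∘ psi), c = arrow_hom epsi ephi e.
Proof.
destruct c as [u v w ei es ep]; simpl in *.
exists (@spl_hom C _ _ F' E' (asrc u) (asrc v) (asrc w)
  (f_equal (@asrc _ _ _) ei) (f_equal (@asrc _ _ _) es)
  (f_equal (@asrc _ _ _) ep)).
exists (@spl_hom C _ _ F E (atgt u) (atgt v) (atgt w)
  (f_equal (@atgt _ _ _) ei) (f_equal (@atgt _ _ _) es)
  (f_equal (@atgt _ _ _) ep)).
unshelve eexists.
- apply spl_hom_ext; [| exact (arr_square v) | exact (arr_square w)].
  simpl; rewrite epsi, ephi; exact (arr_square u).
- apply spl_hom_ext; apply arr_hom_ext; reflexivity.
Qed.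

(** Genericity of [arrow_ext], spelled out in terms of split extensions of C. *)
Definition is_generic_arrow (X' X : C) (E' : SplExtOn X') (E : SplExtOn X)
    (phi : Hom (spl E') (spl E)) : Prop :=
  forall (F' : SplExtOn X') (F : SplExtOn X) (psi : Hom (spl F') (spl F)),
  hker psi = hker phi ->
  exists (a : Hom (spl F') (spl E')) (b : Hom (spl F) (spl E)),
    (hker a = id X' /\ hker b = id X /\ phi ∘ a = b ∘ psi) /\
    forall (a' : Hom (spl F') (spl E')) (b' : Hom (spl F) (spl E)),
      hker a' = id X' -> hker b' = id X -> phi ∘ a' = b' ∘ psi ->
      a' = a /\ b' = b.

Lemma arrow_generic_iff :
  has_generic_split_extensions (PointedArrow C) <->
  forall (X' X : C) (f : Hom X' X),
  exists (E' : SplExtOn X') (E : SplExtOn X) (phi : Hom (spl E') (spl E)),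
    hker phi = f /\ is_generic_arrow phi.
Proof.
rewrite generic_iff; split.
- intros H X' X f; destruct (H (Build_ArrOb f)) as [G gen].
  destruct (arrow_ext_surjective G) as [E' [E [phi [ephi ->]]]].
  exists E', E, phi; split; [exact ephi |]; intros F' F psi epsi'.
  pose proof (eq_trans epsi' ephi) as epsi.
  destruct (gen (arrow_ext epsi)) as [c [ec uniq]].
  destruct (arrow_hom_surjective c) as [a [b [e ->]]].
  exists a, b; split.
  + split; [exact (f_equal (@asrc _ _ _) ec) |].
    split; [exact (f_equal (@atgt _ _ _) ec) | exact e].
  + intros a' b' ea' eb' e'.
    assert (eq : arrow_hom epsi ephi e' = arrow_hom epsi ephi e).
    { apply uniq, arr_hom_ext; [exact ea' | exact eb']. }
    split; apply spl_hom_ext.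
    * exact (f_equal (@asrc _ _ _) (f_equal (@hker _ _ _) eq)).
    * exact (f_equal (@asrc _ _ _) (f_equal (@htot _ _ _) eq)).
    * exact (f_equal (@asrc _ _ _) (f_equal (@hbase _ _ _) eq)).
    * exact (f_equal (@atgt _ _ _) (f_equal (@hker _ _ _) eq)).
    * exact (f_equal (@atgt _ _ _) (f_equal (@htot _ _ _) eq)).
    * exact (f_equal (@atgt _ _ _) (f_equal (@hbase _ _ _) eq)).
- intros H [X' X f]; destruct (H X' X f) as [E' [E [phi [ephi gen]]]].
  exists (arrow_ext ephi); intros G.
  destruct (arrow_ext_surjective G) as [F' [F [psi [epsi ->]]]].
  destruct (gen F' F psi) as [a [b [[ea [eb e]] uniq]]].
  { rewrite epsi, ephi; reflexivity. }
  exists (arrow_hom epsi ephi e); split.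
  + apply arr_hom_ext; [exact ea | exact eb].
  + intros c' ec'; destruct (arrow_hom_surjective c') as [a' [b' [e' ->]]].
    assert (eq : a' = a /\ b' = b).
    { apply uniq; [exact (f_equal (@asrc _ _ _) ec')
                  | exact (f_equal (@atgt _ _ _) ec') | exact e']. }
    destruct eq; subst a' b'; f_equal; apply proof_irrelevance.
Qed.

End ArrowExtensions.

(** * Generic split extensions of arrows and precartesian liftings *)

Section ArrowsAndPrefibrations.
Variables (C : PointedCategory) (L : FiniteLimits C).

(** The free split extension with kernel X: its morphisms to any E correspond to
the morphisms from X to the kernel of E ([discrete_hom], [discrete_hom_ext]). *)
Definition discrete_ext (X : C) : SplExtOn X.
Proof.
refine (@Build_SplExtOn C X X (zero_obj C) (id X) (to_zero X) (from_zero X) _ _).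
- apply is_kernel_intro.
  + rewrite !(to_zero_unique (_ ∘ _)), (to_zero_unique (zero_mor _ _)).
    reflexivity.
  + intros Z g h; rewrite !comp_id_l; trivial.
  + intros Z g _; exists g; apply comp_id_l.
- rewrite (to_zero_unique (_ ∘ _)); symmetry; apply to_zero_unique.
Defined.

Definition discrete_hom (X' X : C) (E : SplExtOn X) (f : Hom X' X) :
  Hom (spl (discrete_ext X')) (spl E).
Proof.
apply (@spl_hom C X' X (discrete_ext X') E f (inj E ∘ f) (from_zero _)); simpl.
- apply comp_id_r.
- rewrite !(from_zero_unique (_ ∘ _)); reflexivity.
- rewrite comp_assoc, prj_inj, comp_zero_l; reflexivity.
Defined.

Lemma discrete_hom_ext (X' X : C) (E : SplExtOn X)
    (c c' : Hom (spl (discrete_ext X')) (spl E)) :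
  hker c = hker c' -> c = c'.
Proof.
intros e; apply spl_hom_ext; [exact e | |].
- generalize (hkappa c) (hkappa c'); simpl; rewrite !comp_id_r, e.
  intros -> ->; reflexivity.
- simpl; rewrite (from_zero_unique (hbase c)); symmetry.
  apply from_zero_unique.
Qed.

Lemma hom_to_discrete_zero_ext (X : C) (E : SplExtOn X)
    (c c' : Hom (spl E) (spl (discrete_ext (zero_obj C)))) :
  c = c'.
Proof.
apply spl_hom_ext; simpl in *;
  [rewrite (to_zero_unique (hker c)) | rewrite (to_zero_unique (htot c))
  | rewrite (to_zero_unique (hbase c))]; symmetry; apply to_zero_unique.
Qed.

(** The split extension with zero kernel and zero base is terminal, so a
precartesian lifting of X -> 0 to it is a terminal object of the fiber over X. *)
Lemma prefibration_generic :
  is_prefibration (K C) -> has_generic_split_extensions C.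
Proof.
rewrite prefibration_iff, generic_iff; intros pre X.
destruct (pre X (zero_obj C) (to_zero X) (discrete_ext _))
  as [E [phi [ephi univ]]].
exists E; intros F.
assert (z : exists z : Hom (spl F) (spl (discrete_ext (zero_obj C))), True).
{ unshelve eexists; [| trivial].
  apply (@spl_hom C _ _ F (discrete_ext (zero_obj C))
    (to_zero _) (to_zero _) (to_zero _)); simpl;
    rewrite !(to_zero_unique (_ ∘ _)); reflexivity. }
destruct z as [z _].
destruct (univ F z) as [c [[ec _] uniq]].
{ rewrite ephi; apply to_zero_unique. }
exists c; split; [exact ec |].
intros c' ec'; apply uniq; [exact ec' | apply hom_to_discrete_zero_ext].
Qed.

(** A split extension F with kernel X is the codomain of a morphism over f
starting at the free split extension with kernel X'.  Since morphisms from the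
latter are determined by their kernel component, mapping this morphism to phi
over identities amounts to mapping F to E over the identity. *)
Lemma generic_arrow_generic (X' X : C) (E' : SplExtOn X') (E : SplExtOn X)
    (phi : Hom (spl E') (spl E)) :
  is_generic_arrow phi -> is_generic E.
Proof.
intros gen F.
destruct (gen (discrete_ext X') F (discrete_hom F (hker phi)) eq_refl)
  as [a [b [[ea [eb _]] uniq]]].
exists b; split; [exact eb |]; intros b' eb'.
apply (uniq a b' ea eb'), discrete_hom_ext; simpl.
rewrite ea, eb', comp_id_r; symmetry; apply comp_id_l.
Qed.

Lemma prefibration_arrow_generic :
  is_prefibration (K C) -> has_generic_split_extensions (PointedArrow C).
Proof.
intros pre; pose proof (prefibration_generic pre) as gen.
rewrite generic_iff in gen; rewrite prefibration_iff in pre.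
rewrite arrow_generic_iff; intros X' X f.
destruct (gen X) as [E genE].
destruct (pre X' X f E) as [E' [phi [ephi univ]]].
exists E', E, phi; split; [exact ephi |]; intros F' F psi epsi.
destruct (genE F) as [b [eb uniqb]].
destruct (univ F' (b ∘ psi)) as [a [[ea e] uniqa]].
{ simpl; rewrite eb, epsi; apply comp_id_l. }
exists a, b; split; [auto |]; intros a' b' ea' eb' e'.
pose proof (uniqb b' eb'); subst b'; split; [apply uniqa; assumption |].
reflexivity.
Qed.

(** Limits of split extensions are computed componentwise.  As t is the identity
on kernels, the kernel of the pullback can be taken to be X' itself. *)
Lemma spl_pullback (X' X : C) (E E0 : SplExtOn X) (E0' : SplExtOn X')
    (t : Hom (spl E) (spl E0)) (phi : Hom (spl E0') (spl E0)) :
  hker t = id X ->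
  exists (P : SplExtOn X') (p : Hom (spl P) (spl E)) (q : Hom (spl P) (spl E0')),
    (hker p = hker phi /\ hker q = id X' /\ t ∘ p = phi ∘ q) /\
    forall (F : SplExtOn X') (a : Hom (spl F) (spl E))
      (b : Hom (spl F) (spl E0')), hker b = id X' -> t ∘ a = phi ∘ b ->
    exists c : Hom (spl F) (spl P),
      (p ∘ c = a /\ q ∘ c = b) /\
      forall c' : Hom (spl F) (spl P), p ∘ c' = a -> q ∘ c' = b -> c' = c.
Proof.
destruct t as [ut vt wt eit est ept], phi as [u v w ei es ep]; simpl in *.
intros ->; pose proof (eq_trans eit (comp_id_r _)) as etE.
set (A := pullback L vt v); set (B := pullback L wt w).
assert (ekP : vt ∘ (inj E ∘ u) = v ∘ inj E0') by (crw etE; symmetry; exact ei).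
assert (epP : wt ∘ (prj E ∘ pb1 L vt v) = w ∘ (prj E0' ∘ pb2 L vt v)).
{ rewrite !comp_assoc, ept, ep; assoc; rewrite pb_square; reflexivity. }
assert (esP : vt ∘ (sec E ∘ pb1 L wt w) = v ∘ (sec E0' ∘ pb2 L wt w)).
{ rewrite !comp_assoc, est, es; assoc; rewrite pb_square; reflexivity. }
assert (kerP : is_kernel (pb_pair L ekP) (pb_pair L epP)).
{ apply is_kernel_intro.
  - apply pb_ext; rewrite !comp_zero_r.
    + crw (pb1_pair L _); crw (pb1_pair L _); crw (prj_inj E); apply comp_zero_l.
    + crw (pb2_pair L _); crw (pb2_pair L _); apply (prj_inj E0').
  - intros Z g h e; apply (kernel_mono (inj_kernel E0')).
    rewrite <- (pb2_pair L ekP); crw e; reflexivity.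
  - intros Z g e.
    assert (e1 : prj E ∘ (pb1 L vt v ∘ g) = zero_mor _ _).
    { rewrite comp_assoc, <- (pb1_pair L epP); crw e; apply comp_zero_r. }
    assert (e2 : prj E0' ∘ (pb2 L vt v ∘ g) = zero_mor _ _).
    { rewrite comp_assoc, <- (pb2_pair L epP); crw e; apply comp_zero_r. }
    destruct (kernel_factor (inj_kernel E) e1) as [l el].
    destruct (kernel_factor (inj_kernel E0') e2) as [l' el'].
    assert (eu : u ∘ l' = l).
    { apply (kernel_mono (inj_kernel E0)).
      rewrite comp_assoc, <- ei, <- etE; assoc; rewrite el, el'.
      rewrite !comp_assoc, pb_square; reflexivity. }
    exists l'; apply pb_ext.
    + crw (pb1_pair L _); rewrite eu; exact el.
    + crw (pb2_pair L _); exact el'. }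
assert (psP : pb_pair L epP ∘ pb_pair L esP = id B).
{ apply pb_ext; rewrite comp_id_r.
  - crw (pb1_pair L _); crw (pb1_pair L _); crw (prj_sec E); apply comp_id_l.
  - crw (pb2_pair L _); crw (pb2_pair L _); crw (prj_sec E0'); apply comp_id_l. }
set (P := Build_SplExtOn kerP psP).
exists P.
exists (@spl_hom C _ _ P E u (pb1 L vt v) (pb1 L wt w) (pb1_pair L _)
  (pb1_pair L _) (pb1_pair L _)).
exists (@spl_hom C _ _ P E0' (id X') (pb2 L vt v) (pb2 L wt w)
  (eq_trans (pb2_pair L _) (eq_sym (comp_id_r _))) (pb2_pair L _)
  (pb2_pair L _)).
split.
{ split; [reflexivity |]; split; [reflexivity |].
  apply spl_hom_ext; simpl; [rewrite comp_id_l, comp_id_r; reflexivity | |];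
    apply pb_square. }
intros F a b eb e.
pose proof (f_equal (@htot _ _ _) e : vt ∘ htot a = v ∘ htot b) as etot.
pose proof (f_equal (@hbase _ _ _) e : wt ∘ hbase a = w ∘ hbase b) as ebase.
pose proof (f_equal (@hker _ _ _) e) as eker; simpl in eker.
rewrite comp_id_l, eb, comp_id_r in eker.
destruct a as [ua va wa eia esa epa], b as [ub vb wb eib esb epb]; simpl in *.
subst ua ub.
assert (ec1 : pb_pair L etot ∘ inj F = inj P ∘ id X').
{ rewrite comp_id_r; apply pb_ext; simpl.
  - crw (pb1_pair L _); crw (pb1_pair L _); exact eia.
  - crw (pb2_pair L _); crw (pb2_pair L _); rewrite eib; apply comp_id_r. }
assert (ec2 : pb_pair L etot ∘ sec F = sec P ∘ pb_pair L ebase).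
{ apply pb_ext; simpl.
  - crw (pb1_pair L _); crw (pb1_pair L _); crw (pb1_pair L _); exact esa.
  - crw (pb2_pair L _); crw (pb2_pair L _); crw (pb2_pair L _); exact esb. }
assert (ec3 : pb_pair L ebase ∘ prj F = prj P ∘ pb_pair L etot).
{ apply pb_ext; simpl.
  - crw (pb1_pair L _); crw (pb1_pair L _); crw (pb1_pair L _); exact epa.
  - crw (pb2_pair L _); crw (pb2_pair L _); crw (pb2_pair L _); exact epb. }
exists (@spl_hom C _ _ F P (id X') (pb_pair L etot) (pb_pair L ebase)
  ec1 ec2 ec3); split.
- split; apply spl_hom_ext; simpl;
    rewrite ?comp_id_r, ?pb1_pair, ?pb2_pair; reflexivity.
- intros c' e1 e2; apply spl_hom_ext; simpl.
  + generalize (f_equal (@hker _ _ _) e2); simpl; rewrite comp_id_l; trivial.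
  + apply pb_ext; rewrite ?pb1_pair, ?pb2_pair.
    * exact (f_equal (@htot _ _ _) e1).
    * exact (f_equal (@htot _ _ _) e2).
  + apply pb_ext; rewrite ?pb1_pair, ?pb2_pair.
    * exact (f_equal (@hbase _ _ _) e1).
    * exact (f_equal (@hbase _ _ _) e2).
Qed.

Lemma arrow_generic_prefibration :
  has_generic_split_extensions (PointedArrow C) -> is_prefibration (K C).
Proof.
rewrite arrow_generic_iff, prefibration_iff; intros H X' X f E.
destruct (H X' X f) as [E0' [E0 [phi [ephi gen]]]].
destruct (generic_arrow_generic gen E) as [t [et uniqt]].
destruct (spl_pullback phi et) as [P [p [q [[ep [eq e]] univ]]]].
exists P, p; split; [congruence |]; intros F psi epsi.
destruct (gen F E psi) as [a [b [[ea [eb eab]] uniq]]]; [congruence |].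
pose proof (uniqt b eb); subst b.
destruct (univ F psi a ea (eq_sym eab)) as [c [[ec1 ec2] uniqc]].
exists c; split.
- split; [| exact ec1].
  rewrite <- ea, <- ec2; simpl; rewrite eq; symmetry; apply comp_id_l.
- intros c' ekc' ec'; apply uniqc; [exact ec' |].
  apply (uniq (q ∘ c') t); [| exact et |].
  + simpl; rewrite eq, ekc'; apply comp_id_l.
  + rewrite comp_assoc, <- e, <- comp_assoc, ec'; reflexivity.
Qed.

End ArrowsAndPrefibrations.

(** * Normalizers *)

Section Normalizers.
Variables (C : PointedCategory) (L : FiniteLimits C).

Section NormalizerData.
Variables (X' X : C) (f : Hom X' X).

Definition related (D : NormalizerData L f) (Z : C) (a b : Hom Z (nz_N D)) :
  Prop := exists x : Hom Z (nz_R D), nz_r1 D ∘ x = a /\ nz_r2 D ∘ x = b.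

Lemma related_equivalence (D : NormalizerData L f) (Z : C) :
  Equivalence (@related D Z).
Proof. apply (nz_equiv D). Qed.

Lemma nz_jointly_mono (D : NormalizerData L f) (Z : C)
    (x y : Hom Z (nz_R D)) :
  nz_r1 D ∘ x = nz_r1 D ∘ y -> nz_r2 D ∘ x = nz_r2 D ∘ y -> x = y.
Proof.
intros e1 e2; destruct (nz_equiv D) as [mono _]; apply mono.
rewrite !pairing_comp, e1, e2; reflexivity.
Qed.

Lemma nz_r1_kappa (D : NormalizerData L f) :
  nz_r1 D ∘ nz_kappa D = zero_mor X' (nz_N D).
Proof.
destruct (nz_pullback D) as [e _]; rewrite !pairing_comp in e.
rewrite <- (comp_zero_l (nz_N D) (nz_n D)); exact (Logic.proj1 (pairing_inj e)).
Qed.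

Lemma nz_r2_kappa (D : NormalizerData L f) : nz_r2 D ∘ nz_kappa D = nz_n D.
Proof.
destruct (nz_pullback D) as [e _]; rewrite !pairing_comp in e.
rewrite (Logic.proj2 (pairing_inj e)); apply comp_id_l.
Qed.

Lemma nz_kappa_kernel (D : NormalizerData L f) :
  is_kernel (nz_kappa D) (nz_r1 D).
Proof.
split; [apply nz_r1_kappa |]; intros Z a ea.
destruct (nz_pullback D) as [_ univ].
destruct (univ Z a (nz_r2 D ∘ a)) as [k [[ek _] uniq]].
{ rewrite !pairing_comp, ea, comp_zero_l, comp_id_l; reflexivity. }
exists k; split; [exact ek |]; intros k' ek'; apply uniq; split; [exact ek' |].
rewrite <- ek', comp_assoc, nz_r2_kappa; reflexivity.
Qed.

(** The pullback condition says exactly that X' is the kernel of the first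
projection of the relation, embedded by the second one. *)
Definition normalizer_data (N R : C) (n : Hom X' N) (m : Hom N X)
    (r1 r2 : Hom R N) (k : Hom X' R) (mn : m ∘ n = f)
    (jm : forall (Z : C) (x y : Hom Z R),
       r1 ∘ x = r1 ∘ y -> r2 ∘ x = r2 ∘ y -> x = y)
    (eqv : forall Z : C, Equivalence (fun a b : Hom Z N =>
       exists x : Hom Z R, r1 ∘ x = a /\ r2 ∘ x = b))
    (ker : is_kernel k r1) (ek : r2 ∘ k = n) : NormalizerData L f.
Proof.
refine (@Build_NormalizerData C L X' X f N R n m r1 r2 k mn _ _).
- split; [| exact eqv]; intros Z x y e.
  destruct (pairing_comp_inj e); apply jm; assumption.
- split.
  + rewrite !pairing_comp, ek, comp_id_l, comp_zero_l; f_equal; apply ker.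
  + intros Z a b; rewrite !pairing_comp, comp_zero_l, comp_id_l; intros e.
    destruct (pairing_inj e) as [e1 e2].
    destruct (kernel_factor ker e1) as [l el].
    exists l; split.
    * split; [exact el |]; rewrite <- ek, <- e2, <- el; symmetry.
      apply comp_assoc.
    * intros l' [el' _]; apply (kernel_mono ker); congruence.
Defined.

(** A morphism from F to a split extension with total object X sends the kernel
pair of F to normalizer data: the class of zero for the kernel pair of prj F is
the kernel of F. *)
Definition kernel_pair_data (F : SplExtOn X') (v : Hom (total F) X)
    (e : v ∘ inj F = f) : NormalizerData L f.
Proof.
assert (e0 : prj F ∘ zero_mor X' (total F) = prj F ∘ inj F).
{ rewrite comp_zero_r; symmetry; apply prj_inj. }
assert (T_lift : forall Z (b c : Hom Z (total F)), prj F ∘ b = prj F ∘ c ->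
  exists h, pb1 L (prj F) (prj F) ∘ h = b /\ pb2 L (prj F) (prj F) ∘ h = c).
{ intros Z b c ebc; exists (pb_pair L ebc); split;
    [apply pb1_pair | apply pb2_pair]. }
refine (@normalizer_data (total F) (pullback L (prj F) (prj F)) (inj F) v
  (pb1 L _ _) (pb2 L _ _) (pb_pair L e0) e _ _ _ (pb2_pair L _)).
- intros Z b c; apply pb_ext.
- intros Z; split.
  + intros b; apply T_lift; reflexivity.
  + intros b c [h [<- <-]]; apply T_lift.
    rewrite !comp_assoc, pb_square; reflexivity.
  + intros b c d [h [<- eh]] [h' [eh' <-]]; apply T_lift.
    rewrite comp_assoc, pb_square, <- comp_assoc, eh, <- eh', !comp_assoc.
    rewrite pb_square; reflexivity.
- apply is_kernel_intro.
  + apply pb1_pair.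
  + intros Z b c ebc; apply (kernel_mono (inj_kernel F)).
    rewrite <- (pb2_pair L e0); crw ebc; reflexivity.
  + intros Z b eb.
    assert (e2 : prj F ∘ (pb2 L (prj F) (prj F) ∘ b) = zero_mor _ _).
    { rewrite comp_assoc, <- pb_square; crw eb; apply comp_zero_r. }
    destruct (kernel_factor (inj_kernel F) e2) as [c ec]; exists c.
    apply pb_ext.
    * crw (pb1_pair L e0); rewrite eb; apply comp_zero_l.
    * crw (pb2_pair L e0); exact ec.
Defined.

Definition nz_map (D' D : NormalizerData L f) (h : Hom (nz_N D') (nz_N D))
    (v : Hom (nz_R D') (nz_R D)) : Prop :=
  nz_m D ∘ h = nz_m D' /\ v ∘ nz_kappa D' = nz_kappa D /\
  nz_r1 D ∘ v = h ∘ nz_r1 D' /\ nz_r2 D ∘ v = h ∘ nz_r2 D'.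

(** A pair (h, v) as in [nz_map] also carries nz_n to nz_n, which is the composite
of nz_r2 and nz_kappa. *)
Lemma nz_map_iff (D' D : NormalizerData L f) (h : Hom (nz_N D') (nz_N D))
    (v : Hom (nz_R D') (nz_R D)) :
  (nz_m D ∘ h = nz_m D' /\ h ∘ nz_n D' = nz_n D /\
   v ∘ nz_kappa D' = nz_kappa D /\
   pairing L (nz_r1 D) (nz_r2 D) ∘ v =
     product_map L h h ∘ pairing L (nz_r1 D') (nz_r2 D')) <->
  nz_map h v.
Proof.
assert (e : product_map L h h ∘ pairing L (nz_r1 D') (nz_r2 D') =
            pairing L (h ∘ nz_r1 D') (h ∘ nz_r2 D')).
{ unfold product_map; rewrite pairing_comp; assoc.
  rewrite proj1_pairing, proj2_pairing; reflexivity. }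
rewrite e, pairing_comp; split.
- intros [em [_ [ek er]]]; destruct (pairing_inj er); repeat split; assumption.
- intros [em [ek [er1 er2]]]; rewrite er1, er2; repeat split; trivial.
  rewrite <- nz_r2_kappa; crw (eq_sym er2); rewrite ek; apply nz_r2_kappa.
Qed.

Lemma is_normalizer_iff (D : NormalizerData L f) :
  is_normalizer D <->
  forall D' : NormalizerData L f,
  exists (h : Hom (nz_N D') (nz_N D)) (v : Hom (nz_R D') (nz_R D)),
    nz_map h v /\
    forall (h' : Hom (nz_N D') (nz_N D)) (v' : Hom (nz_R D') (nz_R D)),
      nz_map h' v' -> h' = h /\ v' = v.
Proof.
split; intros H D'.
- destruct (H D') as [[h v] [e uniq]]; exists h, v.
  split; [apply nz_map_iff; exact e |]; intros h' v' m.
  assert (eq : (h, v) = (h', v')) by (apply uniq, nz_map_iff, m).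
  injection eq; auto.
- destruct (H D') as [h [v [m uniq]]]; exists (h, v).
  split; [apply nz_map_iff; exact m |]; intros [h' v'] e.
  destruct (uniq h' v') as [-> ->]; [apply nz_map_iff; exact e | reflexivity].
Qed.

End NormalizerData.

(** * The split extension classifying extensions of a morphism *)

Definition is_map (X : C) (F E : SplExtOn X) (v : Hom (total F) (total E))
    (w : Hom (basis F) (basis E)) : Prop :=
  v ∘ inj F = inj E /\ v ∘ sec F = sec E ∘ w /\ w ∘ prj F = prj E ∘ v.

Lemma is_map_comp (X : C) (G F E : SplExtOn X)
    (v : Hom (total F) (total E)) (w : Hom (basis F) (basis E))
    (v' : Hom (total G) (total F)) (w' : Hom (basis G) (basis F)) :
  is_map v w -> is_map v' w' -> is_map (F := G) (E := E) (v ∘ v') (w ∘ w').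
Proof.
intros [ei [es ep]] [ei' [es' ep']]; split; [| split].
- crw ei'; exact ei.
- crw es'; crw es; reflexivity.
- crw ep'; crw ep; reflexivity.
Qed.

(** Morphisms from F to [indiscrete_ext X] over f correspond to morphisms
t : total F -> X that restrict to f.  A precartesian lifting of f to that
extension therefore carries a universal such t. *)
Definition classifies (X' X : C) (f : Hom X' X) (E : SplExtOn X')
    (t0 : Hom (total E) X) : Prop :=
  t0 ∘ inj E = f /\
  forall (F : SplExtOn X') (t : Hom (total F) X), t ∘ inj F = f ->
  exists (v : Hom (total F) (total E)) (w : Hom (basis F) (basis E)),
    (is_map v w /\ t0 ∘ v = t) /\
    forall (v' : Hom (total F) (total E)) (w' : Hom (basis F) (basis E)),
      is_map v' w' -> t0 ∘ v' = t -> v' = v /\ w' = w.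

(** In a category of groups, this is the semidirect product of X with itself for
the action by conjugation. *)
Definition indiscrete_ext (X : C) : SplExtOn X.
Proof.
refine (@Build_SplExtOn C X (product L X X) X
  (pairing L (zero_mor X X) (id X)) (proj1 L X X)
  (pairing L (id X) (id X)) _ (proj1_pairing L _ _)).
apply is_kernel_intro.
- apply proj1_pairing.
- intros Z g h; rewrite !pairing_comp, !comp_id_l.
  intros e; apply (pairing_inj e).
- intros Z g e; exists (proj2 L X X ∘ g).
  apply product_ext; rewrite comp_assoc, ?proj1_pairing, ?proj2_pairing.
  + rewrite comp_zero_l; symmetry; exact e.
  + apply comp_id_l.
Defined.

Definition indiscrete_hom (X' X : C) (f : Hom X' X) (F : SplExtOn X')
    (t : Hom (total F) X) (e : t ∘ inj F = f) :
  Hom (spl F) (spl (indiscrete_ext X)).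
Proof.
apply (@spl_hom C X' X F (indiscrete_ext X) f
  (pairing L (t ∘ (sec F ∘ prj F)) t) (t ∘ sec F)); simpl;
  rewrite ?pairing_comp.
- rewrite comp_zero_l, comp_id_l, e; f_equal.
  crw (prj_inj F); rewrite !comp_zero_r; reflexivity.
- rewrite comp_id_l; f_equal; crw (prj_sec F); rewrite comp_id_r; reflexivity.
- rewrite proj1_pairing; symmetry; apply comp_assoc.
Defined.

Lemma indiscrete_hom_ext (X' X : C) (F : SplExtOn X')
    (c c' : Hom (spl F) (spl (indiscrete_ext X))) :
  hker c = hker c' -> proj2 L X X ∘ htot c = proj2 L X X ∘ htot c' -> c = c'.
Proof.
intros ek et; destruct c as [u v w ei es ep], c' as [u' v' w' ei' es' ep'].
simpl in *.
assert (ew : forall v w, v ∘ sec F = pairing L (id X) (id X) ∘ w ->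
   w = proj2 L X X ∘ v ∘ sec F).
{ clear; intros v w e; crw e; rewrite comp_assoc, proj2_pairing.
  symmetry; apply comp_id_l. }
assert (w = w').
{ rewrite (ew _ _ es), (ew _ _ es'), et; reflexivity. }
subst w'; apply spl_hom_ext; simpl; [exact ek | | reflexivity].
apply product_ext; [congruence | exact et].
Qed.

Lemma prefibration_classifier (X' X : C) (f : Hom X' X) :
  is_prefibration (K C) ->
  exists (E : SplExtOn X') (t0 : Hom (total E) X), classifies f t0.
Proof.
rewrite prefibration_iff; intros pre.
destruct (pre X' X f (indiscrete_ext X)) as [E [phi [ephi univ]]].
exists E, (proj2 L X X ∘ htot phi).
assert (et : proj2 L X X ∘ htot phi ∘ inj E = f).
{ generalize (hkappa phi); simpl; intros ek; rewrite <- comp_assoc, ek, ephi.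
  rewrite comp_assoc, proj2_pairing; apply comp_id_l. }
split; [exact et |]; intros F t e.
destruct (univ F (indiscrete_hom e)) as [c [[ec e'] uniq]].
{ symmetry; exact ephi. }
destruct c as [u v w ei es ep]; simpl in *; subst u.
exists v, w; split; [split; [split; [| split; assumption] |] |].
- rewrite ei; apply comp_id_r.
- generalize (f_equal (@htot _ _ _) e'); simpl; intros et'.
  crw et'; apply proj2_pairing.
- intros v' w' [ei' [es' ep']] et'.
  rewrite <- (comp_id_r (inj E)) in ei'.
  assert (eq : @spl_hom C X' X' F E (id X') v' w' ei' es' ep' =
               @spl_hom C X' X' F E (id X') v w ei es ep).
  { apply uniq; [reflexivity |]; apply indiscrete_hom_ext; simpl.
    - rewrite comp_id_r; exact ephi.
    - rewrite proj2_pairing, comp_assoc; exact et'. }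
  split; [exact (f_equal (@htot _ _ _) eq) | exact (f_equal (@hbase _ _ _) eq)].
Qed.

(** * Targets of the elements of a classifying extension *)

Section Twist.
Variables (X' : C) (E : SplExtOn X').

(** The base change of E along the source of b, with b as its section in place
of the section of E.  In terms of generalized elements, its elements over z are
the elements of E with the same source as b z. *)
Definition twist (Z : C) (b : Hom Z (total E)) : SplExtOn X'.
Proof.
assert (ek : prj E ∘ inj E = (prj E ∘ b) ∘ zero_mor X' Z).
{ rewrite prj_inj, comp_zero_r; reflexivity. }
assert (es : prj E ∘ b = (prj E ∘ b) ∘ id Z).
{ symmetry; apply comp_id_r. }
refine (@Build_SplExtOn C X' (pullback L (prj E) (prj E ∘ b)) Z
  (pb_pair L ek) (pb2 L _ _) (pb_pair L es) _ (pb2_pair L _)).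
apply is_kernel_intro.
- apply pb2_pair.
- intros Y g h e; apply (kernel_mono (inj_kernel E)).
  rewrite <- (pb1_pair L ek); crw e; reflexivity.
- intros Y g e.
  assert (e' : prj E ∘ (pb1 L (prj E) (prj E ∘ b) ∘ g) = zero_mor _ _).
  { rewrite comp_assoc, pb_square, <- comp_assoc, e; apply comp_zero_r. }
  destruct (kernel_factor (inj_kernel E) e') as [l el].
  exists l; apply pb_ext.
  + crw (pb1_pair L ek); exact el.
  + crw (pb2_pair L ek); rewrite e; apply comp_zero_l.
Defined.

Definition elt (Z : C) (b : Hom Z (total E)) :
  Hom (total (twist b)) (total E) := pb1 L (prj E) (prj E ∘ b).

Lemma elt_inj (Z : C) (b : Hom Z (total E)) : elt b ∘ inj (twist b) = inj E.
Proof. apply pb1_pair. Qed.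

Lemma elt_sec (Z : C) (b : Hom Z (total E)) : elt b ∘ sec (twist b) = b.
Proof. apply pb1_pair. Qed.

Lemma prj_elt (Z : C) (b : Hom Z (total E)) :
  prj E ∘ elt b = prj E ∘ (b ∘ prj (twist b)).
Proof. rewrite comp_assoc; apply pb_square. Qed.

Lemma twist_lift (Z : C) (b : Hom Z (total E)) (Y : C)
    (c : Hom Y (total E)) (z : Hom Y Z) :
  prj E ∘ c = prj E ∘ (b ∘ z) ->
  exists h : Hom Y (total (twist b)), elt b ∘ h = c /\ prj (twist b) ∘ h = z.
Proof.
rewrite comp_assoc; intros e; exists (pb_pair L e).
split; [apply pb1_pair | apply pb2_pair].
Qed.

Lemma twist_ext (Z : C) (b : Hom Z (total E)) (Y : C)
    (h k : Hom Y (total (twist b))) :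
  elt b ∘ h = elt b ∘ k -> prj (twist b) ∘ h = prj (twist b) ∘ k -> h = k.
Proof. apply pb_ext. Qed.

Lemma twist_map (F : SplExtOn X') (Z : C) (b : Hom Z (total E))
    (c : Hom (total F) (total E)) (k : Hom (basis F) Z) :
  c ∘ inj F = inj E -> c ∘ sec F = b ∘ k ->
  prj E ∘ c = prj E ∘ (b ∘ (k ∘ prj F)) ->
  exists h : Hom (total F) (total (twist b)),
    is_map (E := twist b) h k /\ elt b ∘ h = c.
Proof.
intros ei es ep; destruct (twist_lift ep) as [h [e1 e2]].
exists h; split; [| exact e1]; split; [| split].
- apply twist_ext.
  + rewrite elt_inj; crw e1; exact ei.
  + crw e2; rewrite !prj_inj, comp_zero_r; reflexivity.
- apply twist_ext.
  + crw e1; crw (elt_sec b); exact es.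
  + crw e2; crw (prj_sec (twist b)).
    rewrite prj_sec, comp_id_r, comp_id_l; reflexivity.
- symmetry; exact e2.
Qed.

End Twist.

Section Classifier.
Variables (X' X : C) (f : Hom X' X) (E : SplExtOn X') (t0 : Hom (total E) X).
Hypothesis t0_classifies : classifies f t0.

(** The equations satisfied by the target map all come from this: two maps out
of the same split extension are equal, also on bases, as soon as they agree
after composition with t0 on total objects. *)
Lemma maps_agree (F : SplExtOn X') (v v' : Hom (total F) (total E))
    (w w' : Hom (basis F) (basis E)) :
  is_map v w -> is_map v' w' -> t0 ∘ v = t0 ∘ v' -> v = v' /\ w = w'.
Proof.
intros m m' e; destruct t0_classifies as [et univ].
destruct (univ F (t0 ∘ v')) as [c [d [_ uniq]]].
{ destruct m' as [ei _]; crw ei; exact et. }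
destruct (uniq v w m e) as [-> ->].
destruct (uniq v' w' m' eq_refl) as [-> ->]; auto.
Qed.

(** If the elements of E are thought of as arrows of a groupoid with objects the
elements of the base, then d sends an element c with the same source as b to the
composite of c with the inverse of b, and r is the target of b. *)
Definition has_target (Z : C) (b : Hom Z (total E)) (r : Hom Z (basis E)) : Prop :=
  exists d : Hom (total (twist b)) (total E),
    is_map (F := twist b) d r /\ t0 ∘ d = t0 ∘ elt b.

Lemma has_target_unique (Z : C) (b : Hom Z (total E)) (r r' : Hom Z (basis E)) :
  has_target b r -> has_target b r' -> r = r'.
Proof.
intros [d [m e]] [d' [m' e']]; apply (maps_agree m m'); congruence.
Qed.

Lemma has_target_exists (Z : C) (b : Hom Z (total E)) :
  exists r : Hom Z (basis E), has_target b r.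
Proof.
destruct t0_classifies as [et univ].
destruct (univ (twist b) (t0 ∘ elt b)) as [d [r [md _]]].
- crw (elt_inj b); exact et.
- exists r, d; exact md.
Qed.

(** A map between twists over the base morphism k, given by its component c in E,
transports targets. *)
Lemma has_target_along (Z Z' : C) (b : Hom Z (total E)) (b' : Hom Z' (total E))
    (r : Hom Z' (basis E)) (c : Hom (total (twist b)) (total E))
    (k : Hom Z Z') :
  c ∘ inj (twist b) = inj E -> c ∘ sec (twist b) = b' ∘ k ->
  prj E ∘ c = prj E ∘ (b' ∘ (k ∘ prj (twist b))) -> t0 ∘ c = t0 ∘ elt b ->
  has_target b' r -> has_target b (r ∘ k).
Proof.
intros ei es ep et [d [md ed]].
destruct (@twist_map X' E (twist b) Z' b' c k ei es ep) as [h [mh eh]].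
exists (d ∘ h); split; [exact (is_map_comp md mh) |].
crw ed; rewrite eh; exact et.
Qed.

Lemma has_target_comp (Z Z' : C) (b : Hom Z (total E)) (r : Hom Z (basis E))
    (k : Hom Z' Z) :
  has_target b r -> has_target (b ∘ k) (r ∘ k).
Proof.
apply has_target_along with (c := elt (b ∘ k)).
- apply elt_inj.
- apply elt_sec.
- rewrite prj_elt; assoc; reflexivity.
- reflexivity.
Qed.

Lemma has_target_sec : has_target (sec E) (id (basis E)).
Proof.
exists (elt (sec E)); split; [| reflexivity]; split; [| split].
- apply elt_inj.
- rewrite elt_sec; symmetry; apply comp_id_r.
- rewrite comp_id_l, prj_elt, comp_assoc, prj_sec; symmetry; apply comp_id_l.
Qed.

(** The witness y is the composite of b with the inverse of a.  Its target is that
of b because c -> (c composed with the inverse of a) maps the twist by b to the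
twist by y, sending the section b to the section y. *)
Lemma has_target_euclidean (Z : C) (a b : Hom Z (total E))
    (r r' : Hom Z (basis E)) :
  prj E ∘ a = prj E ∘ b -> has_target a r -> has_target b r' ->
  exists y : Hom Z (total E),
    prj E ∘ y = r /\ t0 ∘ y = t0 ∘ b /\ has_target y r'.
Proof.
intros eab [d [[di [ds dp]] ed]] mb.
assert (eh : prj E ∘ elt b = prj E ∘ (a ∘ prj (twist b))).
{ rewrite prj_elt, !comp_assoc, eab; reflexivity. }
assert (ey : prj E ∘ b = prj E ∘ (a ∘ id Z)).
{ rewrite comp_id_r, eab; reflexivity. }
destruct (twist_lift eh) as [h [h1 h2]], (twist_lift ey) as [g [g1 g2]].
assert (ehs : h ∘ sec (twist b) = g).
{ apply twist_ext.
  - crw h1; exact (eq_trans (elt_sec b) (eq_sym g1)).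
  - crw h2; exact (eq_trans (prj_sec (twist b)) (eq_sym g2)). }
assert (ehi : h ∘ inj (twist b) = inj (twist a)).
{ apply twist_ext; [crw h1 | crw h2].
  - exact (eq_trans (elt_inj b) (eq_sym (elt_inj a))).
  - exact (eq_trans (prj_inj (twist b)) (eq_sym (prj_inj (twist a)))). }
exists (d ∘ g); split; [| split].
- crw (eq_sym dp); rewrite g2; apply comp_id_r.
- crw ed; rewrite g1; reflexivity.
- destruct (has_target_exists (d ∘ g)) as [r'' m''].
  assert (m : has_target b (r'' ∘ id Z)).
  { apply has_target_along with (b' := d ∘ g) (c := d ∘ h); [| | | | exact m''].
    - crw ehi; exact di.
    - crw ehs; rewrite comp_id_r; reflexivity.
    - crw (eq_sym dp); crw (eq_sym dp); rewrite h2, comp_id_l; crw g2.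
      rewrite comp_id_l; reflexivity.
    - crw ed; rewrite h1; reflexivity. }
  rewrite comp_id_r in m; rewrite (has_target_unique mb m); exact m''.
Qed.

(** The twist of F by the universal element is the kernel pair of prj F.  From it
there are two maps to E: one is v on both factors followed by the division that
defines the target of v, the other is the division of the equivalence relation F
followed by v.  They agree after composition with t0, hence on bases. *)
Lemma has_target_equivalence_relation (F : SplExtOn X')
    (r2 : Hom (total F) (basis F)) (m : Hom (basis F) X)
    (v : Hom (total F) (total E)) (h : Hom (basis F) (basis E)) :
  (forall (Z : C) (x y : Hom Z (total F)), prj F ∘ x = prj F ∘ y ->
     r2 ∘ x = r2 ∘ y -> x = y) ->
  (forall Z : C, Equivalence (fun a b : Hom Z (basis F) =>
     exists x : Hom Z (total F), prj F ∘ x = a /\ r2 ∘ x = b)) ->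
  r2 ∘ sec F = id (basis F) -> is_map v h -> t0 ∘ v = m ∘ r2 ->
  has_target v (h ∘ r2).
Proof.
intros jm eqv e2s mv etv; pose proof mv as [vi [vs vp]].
set (G := twist (id (total F))).
set (c := elt (id (total F)) : Hom (total G) (total F)).
set (a := prj G : Hom (total G) (total F)).
assert (eca : prj F ∘ c = prj F ∘ a).
{ exact (eq_trans (prj_elt (E := F) _)
    (f_equal (fun g => prj F ∘ g) (comp_id_l _))). }
assert (ci : c ∘ inj G = inj F) by apply elt_inj.
assert (cs : c ∘ sec G = id (total F)) by apply elt_sec.
assert (ai : a ∘ inj G = zero_mor X' (total F)) by apply (prj_inj G).
assert (as' : a ∘ sec G = id (total F)) by apply (prj_sec G).
assert (ey : exists y, prj F ∘ y = r2 ∘ a /\ r2 ∘ y = r2 ∘ c).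
{ destruct (eqv (total G)) as [_ sym trans].
  apply (trans _ (prj F ∘ a)); [apply sym |]; eauto. }
destruct ey as [y [y1 y2]].
assert (my : is_map (F := G) (E := F) y r2).
{ split; [| split].
  - apply jm.
    + crw y1; rewrite ai, prj_inj; apply comp_zero_r.
    + crw y2; rewrite ci; reflexivity.
  - apply jm.
    + crw y1; transitivity r2.
      * transitivity (r2 ∘ id (total F)); [f_equal; exact as' |].
        apply comp_id_r.
      * rewrite comp_assoc, prj_sec; symmetry; apply comp_id_l.
    + crw y2; transitivity (r2 ∘ id (total F)); [f_equal; exact cs |].
      crw e2s; rewrite comp_id_l; apply comp_id_r.
  - symmetry; exact y1. }
destruct (has_target_exists v) as [r mr]; pose proof mr as [d [md ed]].
destruct (@twist_map X' E G (total F) v (v ∘ c) (id (total F))) as [g [mg eg]].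
- crw ci; exact vi.
- assoc; f_equal; exact cs.
- rewrite comp_assoc, <- vp; assoc; rewrite eca, !comp_assoc, vp; assoc.
  f_equal; f_equal; symmetry; apply comp_id_l.
- destruct (maps_agree (is_map_comp md mg) (is_map_comp mv my)) as [_ e].
  + crw ed; crw etv; rewrite y2, eg; crw etv; reflexivity.
  + rewrite <- (eq_trans (eq_sym (comp_id_r r)) e : r = h ∘ r2); exact mr.
Qed.

Hypothesis f_mono : is_mono f.

(** The object of pairs of elements with the same source and the same image under
t0 is a split extension of basis E.  Its kernel consists of the pairs of elements
of X' with the same image under f, so it is X' when f is a monomorphism.  The
two projections to E agree after composition with t0, so they are equal. *)
Lemma classifier_jointly_mono (Z : C) (a b : Hom Z (total E)) :
  prj E ∘ a = prj E ∘ b -> t0 ∘ a = t0 ∘ b -> a = b.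
Proof.
(* The pairs form the kernel pair of g. *)
set (g := pairing L (prj E) t0).
assert (eg : prj E ∘ pb1 L g g = prj E ∘ pb2 L g g /\
             t0 ∘ pb1 L g g = t0 ∘ pb2 L g g).
{ exact (pairing_comp_inj (pb_square L g g)). }
destruct eg as [eg1 eg2].
set (p := prj E ∘ pb1 L g g).
set (k := pb_pair L (eq_refl (g ∘ inj E))).
set (s := pb_pair L (eq_refl (g ∘ sec E))).
assert (kerQ : is_kernel k p).
{ unfold k, p; apply is_kernel_intro.
  - crw (pb1_pair L _); apply prj_inj.
  - intros Y h l e; apply (kernel_mono (inj_kernel E)).
    rewrite <- (pb1_pair L (eq_refl (g ∘ inj E))); crw e; reflexivity.
  - intros Y h e; rewrite <- comp_assoc in e.
    destruct (kernel_factor (inj_kernel E) e) as [l el].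
    rewrite comp_assoc, eg1, <- comp_assoc in e.
    destruct (kernel_factor (inj_kernel E) e) as [l' el'].
    assert (l = l').
    { apply f_mono; destruct t0_classifies as [et _]; rewrite <- et; assoc.
      rewrite el, el', !comp_assoc, eg2; reflexivity. }
    subst l'; exists l; apply pb_ext; [crw (pb1_pair L _) | crw (pb2_pair L _)];
      assumption. }
assert (psQ : p ∘ s = id (basis E)).
{ unfold p, s; crw (pb1_pair L _); apply prj_sec. }
destruct (@maps_agree (Build_SplExtOn kerQ psQ) (pb1 L g g) (pb2 L g g)
  (id (basis E)) (id (basis E))) as [e _].
- split; [apply pb1_pair |]; split; simpl.
  + rewrite comp_id_r; apply pb1_pair.
  + apply comp_id_l.
- split; [apply pb2_pair |]; split; simpl.
  + rewrite comp_id_r; apply pb2_pair.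
  + rewrite comp_id_l; exact eg1.
- exact eg2.
- intros e1 e2; assert (eab : g ∘ a = g ∘ b).
  { unfold g; rewrite !pairing_comp, e1, e2; reflexivity. }
  rewrite <- (pb1_pair L eab), <- (pb2_pair L eab), e; reflexivity.
Qed.

(** The relation is total E, with prj E and the target r2 of the universal element
as its projections. *)
Lemma classifier_normalizer :
  exists D : NormalizerData L f, is_normalizer D.
Proof.
pose proof classifier_jointly_mono as jm.
destruct (has_target_exists (id (total E))) as [r2 m2].
assert (mv : forall (Z : C) (b : Hom Z (total E)), has_target b (r2 ∘ b)).
{ intros Z b; rewrite <- (comp_id_l b) at 1; exact (has_target_comp b m2). }
assert (r2_eq : forall (Z : C) (b : Hom Z (total E)) (r : Hom Z (basis E)),
  has_target b r -> r2 ∘ b = r).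
{ intros Z b r; exact (has_target_unique (mv Z b)). }
set (m := t0 ∘ sec E).
assert (er2s : r2 ∘ sec E = id (basis E)) by (apply r2_eq, has_target_sec).
(* The value of t0 at an element is the value of m at its target: the section of
   the twist goes to the identity at the target. *)
assert (em : m ∘ r2 = t0).
{ unfold m; destruct m2 as [d [[_ [ds _]] ed]]; assoc.
  transitivity (t0 ∘ (d ∘ sec (twist (id (total E))))).
  - f_equal; symmetry; exact ds.
  - crw ed; rewrite elt_sec; apply comp_id_r. }
assert (jmr : forall (Z : C) (x y : Hom Z (total E)),
  prj E ∘ x = prj E ∘ y -> r2 ∘ x = r2 ∘ y -> x = y).
{ intros Z x y e1 e2; apply jm; [exact e1 |].
  rewrite <- em; assoc; rewrite e2; reflexivity. }
assert (eucl : forall (Z : C) (a b : Hom Z (total E)),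
  prj E ∘ a = prj E ∘ b ->
  exists y : Hom Z (total E), prj E ∘ y = r2 ∘ a /\ r2 ∘ y = r2 ∘ b).
{ intros Z a b e; destruct (has_target_euclidean e (mv Z a) (mv Z b))
    as [y [e1 [_ e2]]]; exists y; split; [exact e1 | apply r2_eq, e2]. }
assert (refl : forall (Z : C) (a : Hom Z (basis E)),
  prj E ∘ (sec E ∘ a) = a /\ r2 ∘ (sec E ∘ a) = a).
{ intros Z a; rewrite !comp_assoc, prj_sec, er2s, comp_id_l; auto. }
assert (sym : forall (Z : C) (x : Hom Z (total E)),
  exists y, prj E ∘ y = r2 ∘ x /\ r2 ∘ y = prj E ∘ x).
{ intros Z x; destruct (refl Z (prj E ∘ x)) as [e1 e2].
  destruct (eucl Z x (sec E ∘ (prj E ∘ x)) (eq_sym e1)) as [y [e3 e4]].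
  exists y; split; [exact e3 | congruence]. }
assert (eqv : forall Z : C, Equivalence (fun a b : Hom Z (basis E) =>
  exists x : Hom Z (total E), prj E ∘ x = a /\ r2 ∘ x = b)).
{ intros Z; split.
  - intros a; exists (sec E ∘ a); apply refl.
  - intros a b [x [<- <-]]; apply sym.
  - intros a b c [x [<- e]] [y [<- <-]]; destruct (sym Z x) as [z [e1 e2]].
    destruct (eucl Z z y) as [w [e3 e4]]; [congruence |].
    exists w; split; congruence. }
destruct t0_classifies as [et univ].
assert (emn : m ∘ (r2 ∘ inj E) = f) by (rewrite comp_assoc, em; exact et).
exists (normalizer_data emn jmr eqv (inj_kernel E) eq_refl).
apply is_normalizer_iff; intros D'.
assert (es : exists s, nz_r1 D' ∘ s = id (nz_N D') /\
                       nz_r2 D' ∘ s = id (nz_N D')).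
{ apply (related_equivalence D' (nz_N D')). }
destruct es as [s [es1 es2]].
set (F := Build_SplExtOn (nz_kappa_kernel D') es1).
assert (etF : (nz_m D' ∘ nz_r2 D') ∘ inj F = f).
{ simpl; rewrite <- comp_assoc, nz_r2_kappa; apply nz_mn. }
destruct (univ F _ etF) as [v [h [[[ei [es ep]] ev] uniq]]]; simpl in *.
exists h, v; split.
- split; [| split; [exact ei | split; [symmetry; exact ep |]]]; simpl.
  + unfold m; crw (eq_sym es); crw ev; rewrite es2; apply comp_id_r.
  + simpl.
    apply r2_eq.
    apply (@has_target_equivalence_relation F (nz_r2 D'))
      with (m := nz_m D'); trivial.
    * apply nz_jointly_mono.
    * apply related_equivalence.
    * split; [exact ei | split; [exact es | exact ep]].
- intros h' v' [em' [ek' [er1 er2]]]; apply and_comm, uniq;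
    [split; [exact ek' |] |];
    simpl in *.
  + split; [| symmetry; exact er1].
    apply jmr; [crw er1; rewrite es1 | crw er2; rewrite es2];
      rewrite comp_id_r; symmetry; apply refl.
  + rewrite <- em, <- em'; assoc; rewrite er2; reflexivity.
Qed.

End Classifier.

(** * Precartesian liftings from normalizers *)

(** Let m : N -> total E be the normalizer of X' in total E, with relation R.  The
base of the lifting is the part W of N that m maps into the section of E.  Its
total object consists of the elements of R whose source lies in W and whose two
ends have the same image in basis E: this last condition makes the morphism to E
compatible with the projections.  A morphism F -> E over f sends the kernel pair
of F to E and so factors through N; the section of F then lands in W. *)
Lemma normalizer_universal_lift (X' X : C) (f : Hom X' X) (E : SplExtOn X) :
  admits_normalizers L -> is_mono f ->
  exists (E' : SplExtOn X') (phi : Hom (spl E') (spl E)),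
    hker phi = f /\ is_universal phi.
Proof.
intros norm fm.
destruct (norm X' (total E) (inj E ∘ f)
  (mono_comp (kernel_mono (inj_kernel E)) fm)) as [D univD].
rewrite is_normalizer_iff in univD.
set (N := nz_N D) in *; set (R := nz_R D) in *.
set (r1 := nz_r1 D : Hom R N); set (r2 := nz_r2 D : Hom R N).
set (m := nz_m D : Hom N (total E)); set (k := nz_kappa D : Hom X' R).
assert (emk : m ∘ (r2 ∘ k) = inj E ∘ f).
{ unfold m, r2, k, R, N; rewrite nz_r2_kappa; apply nz_mn. }
assert (er1k : r1 ∘ k = zero_mor X' N) by apply nz_r1_kappa.
assert (kerk : is_kernel k r1) by apply nz_kappa_kernel.
assert (jm : forall (Z : C) (x y : Hom Z R),
  r1 ∘ x = r1 ∘ y -> r2 ∘ x = r2 ∘ y -> x = y) by apply nz_jointly_mono.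
assert (es : exists s : Hom N R, r1 ∘ s = id N /\ r2 ∘ s = id N).
{ apply (related_equivalence D N). }
destruct es as [s [es1 es2]].
(* The base: j is its inclusion in N and w its morphism to the base of E. *)
set (W := pullback L m (sec E)).
set (j := pb1 L m (sec E) : Hom W N).
set (w := pb2 L m (sec E) : Hom W (basis E)).
assert (ejw : m ∘ j = sec E ∘ w) by apply pb_square.
(* The total object: pairs of x in R and y in W with source of x equal to y and
   target of x over w y. *)
set (g := pairing L r1 (prj E ∘ (m ∘ r2))); set (l := pairing L j w).
set (a := pb1 L g l); set (z := pb2 L g l).
assert (eaz : r1 ∘ a = j ∘ z /\ (prj E ∘ (m ∘ r2)) ∘ a = w ∘ z).
{ apply (@pairing_inj C L); rewrite <- !pairing_comp; apply pb_square. }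
destruct eaz as [eaz1 eaz2].
assert (P_ext : forall Z (x y : Hom Z (pullback L g l)),
  a ∘ x = a ∘ y -> z ∘ x = z ∘ y -> x = y) by (intros; apply pb_ext; trivial).
assert (P_lift : forall Z (x : Hom Z R) (y : Hom Z W),
  r1 ∘ x = j ∘ y -> prj E ∘ (m ∘ (r2 ∘ x)) = w ∘ y ->
  exists h, a ∘ h = x /\ z ∘ h = y).
{ intros Z x y e1 e2.
  assert (e : g ∘ x = l ∘ y).
  { unfold g, l; rewrite !pairing_comp; assoc; congruence. }
  exists (pb_pair L e); split; [apply pb1_pair | apply pb2_pair]. }
destruct (P_lift X' k (zero_mor X' W)) as [i [ai zi]].
{ rewrite comp_zero_r; exact er1k. }
{ rewrite emk, comp_zero_r; crw (prj_inj E); apply comp_zero_l. }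
destruct (P_lift W (s ∘ j) (id W)) as [t [at' zt]].
{ crw es1; rewrite comp_id_l, comp_id_r; reflexivity. }
{ crw es2; rewrite comp_id_l, ejw, comp_id_r; crw (prj_sec E).
  apply comp_id_l. }
assert (kerP : is_kernel i z).
{ apply is_kernel_intro; [exact zi | |].
  - intros Z x y e; apply (kernel_mono kerk); rewrite <- ai; crw e; reflexivity.
  - intros Z x ex.
    assert (e1 : r1 ∘ (a ∘ x) = zero_mor Z N).
    { crw eaz1; rewrite ex; apply comp_zero_r. }
    destruct (kernel_factor kerk e1) as [y ey]; exists y; apply P_ext.
    + crw ai; exact ey.
    + crw zi; rewrite ex; apply comp_zero_l. }
set (E' := Build_SplExtOn kerP zt); exists E'.
assert (phi_i : (m ∘ (r2 ∘ a)) ∘ inj E' = inj E ∘ f).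
{ simpl; assoc; rewrite ai; exact emk. }
assert (phi_s : (m ∘ (r2 ∘ a)) ∘ sec E' = sec E ∘ w).
{ simpl; assoc; rewrite at'; crw es2; rewrite comp_id_l; exact ejw. }
assert (phi_p : w ∘ prj E' = prj E ∘ (m ∘ (r2 ∘ a))).
{ simpl; rewrite <- eaz2; assoc; reflexivity. }
exists (@spl_hom C X' X E' E f _ w phi_i phi_s phi_p); split; [reflexivity |].
intros F [u v x ei esx ep] eu; simpl in eu; subst u; simpl in ei, esx, ep, v, x.
set (D' := kernel_pair_data ei).
destruct (univD D') as [h [vT [[hm [hk [h1 h2]]] uniq]]].
set (T := pullback L (prj F) (prj F)).
set (q1 := nz_r1 D' : Hom T (total F)); set (q2 := nz_r2 D' : Hom T (total F)).
set (kT := nz_kappa D' : Hom X' T); change (Hom T R) in vT.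
assert (eq12 : prj F ∘ q1 = prj F ∘ q2) by apply pb_square.
assert (kT1 : q1 ∘ kT = zero_mor X' (total F)) by apply pb1_pair.
assert (kT2 : q2 ∘ kT = inj F) by apply pb2_pair.
change (Hom (total F) N) in h; change (m ∘ h = v) in hm.
change (vT ∘ kT = k) in hk.
change (r1 ∘ vT = h ∘ q1) in h1; change (r2 ∘ vT = h ∘ q2) in h2.
assert (hi : h ∘ inj F = r2 ∘ k).
{ rewrite <- hk; crw h2; rewrite kT2; reflexivity. }
(* The element (sec (prj c), c) of the kernel pair recovers c in F, and its image
   in R is the value at c of the required factorization. *)
assert (ed : exists d, q1 ∘ d = sec F ∘ prj F /\ q2 ∘ d = id (total F)).
{ assert (e : prj F ∘ (sec F ∘ prj F) = prj F ∘ id (total F)).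
  { rewrite comp_assoc, prj_sec, comp_id_l, comp_id_r; reflexivity. }
  exists (pb_pair L e); split; [apply pb1_pair | apply pb2_pair]. }
destruct ed as [d [d1 d2]].
assert (r1d : r1 ∘ (vT ∘ d) = h ∘ (sec F ∘ prj F)).
{ crw h1; rewrite d1; reflexivity. }
assert (r2d : r2 ∘ (vT ∘ d) = h).
{ crw h2; rewrite d2; apply comp_id_r. }
assert (ey : exists y, j ∘ y = h ∘ sec F /\ w ∘ y = x).
{ assert (e : m ∘ (h ∘ sec F) = sec E ∘ x) by (crw hm; exact esx).
  exists (pb_pair L e); split; [apply pb1_pair | apply pb2_pair]. }
destruct ey as [y [jy wy]].
destruct (P_lift (total F) (vT ∘ d) (y ∘ prj F)) as [c [ac zc]].
{ rewrite r1d; crw jy; reflexivity. }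
{ rewrite r2d, hm, <- ep; crw wy; reflexivity. }
assert (ci : c ∘ inj F = inj E' ∘ id X').
{ rewrite comp_id_r; apply P_ext; simpl.
  - crw ac; rewrite ai; apply jm.
    + rewrite er1k; assoc; crw h1; crw d1; crw (prj_inj F).
      rewrite !comp_zero_r; reflexivity.
    + assoc; crw h2; crw d2; rewrite comp_id_l; exact hi.
  - rewrite zi; crw zc; crw (prj_inj F); apply comp_zero_r. }
assert (cs : c ∘ sec F = sec E' ∘ y).
{ apply P_ext; simpl.
  - crw ac; crw at'; apply jm; assoc.
    + crw h1; crw d1; crw (prj_sec F); crw es1.
      rewrite comp_id_l, comp_id_r; symmetry; exact jy.
    + crw h2; crw d2; crw es2; rewrite !comp_id_l; symmetry; exact jy.
  - crw zc; crw zt; crw (prj_sec F); rewrite comp_id_l, comp_id_r.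
    reflexivity. }
exists (@spl_hom C X' X' F E' (id X') c y ci cs (eq_sym zc)); split.
- split; [reflexivity |]; apply spl_hom_ext; simpl.
  + apply comp_id_r.
  + assoc; rewrite ac, r2d; exact hm.
  + exact wy.
- intros [u c' y' ci' cs' cp'] eu ephi; simpl in eu; subst u; simpl in *.
  pose proof (f_equal (@htot _ _ _) ephi : (m ∘ (r2 ∘ a)) ∘ c' = v) as ev.
  pose proof (f_equal (@hbase _ _ _) ephi : w ∘ y' = x) as ex.
  change (y' ∘ prj F = z ∘ c') in cp'; change (c' ∘ sec F = t ∘ y') in cs'.
  change (c' ∘ inj F = i ∘ id X') in ci'.
  assert (r1c : r1 ∘ (a ∘ c') = j ∘ (y' ∘ prj F)).
  { crw eaz1; rewrite cp'; reflexivity. }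
  (* Any other factorization c' gives a map of normalizer data, whose component in
     N is the target of a c'. *)
  assert (eh : r2 ∘ (a ∘ c') = h).
  { assert (evy : exists vy, r1 ∘ vy = (r2 ∘ (a ∘ c')) ∘ q1 /\
                             r2 ∘ vy = (r2 ∘ (a ∘ c')) ∘ q2).
    { destruct (related_equivalence D (nz_R D')) as [_ sym trans].
      apply (trans _ (r1 ∘ (a ∘ c' ∘ q1))); [apply sym |].
      - exists (a ∘ c' ∘ q1); assoc; auto.
      - exists (a ∘ c' ∘ q2); split; [| assoc; reflexivity].
        transitivity ((r1 ∘ (a ∘ c')) ∘ q2); [assoc; reflexivity |].
        transitivity ((r1 ∘ (a ∘ c')) ∘ q1); [| assoc; reflexivity].
        rewrite r1c; assoc; rewrite eq12; reflexivity. }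
    destruct evy as [vy [vy1 vy2]].
    apply (uniq _ vy); split; [| split; [| split; [exact vy1 | exact vy2]]].
    - refine (eq_trans _ ev); unfold m; assoc; reflexivity.
    - change (vy ∘ kT = k); apply jm.
      + crw vy1; rewrite kT1, er1k, !comp_zero_r; reflexivity.
      + crw vy2; rewrite kT2, ci', comp_id_r, ai; reflexivity. }
  assert (ey : y' = y).
  { apply pb_ext; [| exact (eq_trans ex (eq_sym wy))].
    change (j ∘ y' = j ∘ y); rewrite jy, <- eh; assoc; rewrite cs'; crw at'.
    crw es2; rewrite comp_id_l; reflexivity. }
  subst y'; apply spl_hom_ext; simpl; [reflexivity | | reflexivity].
  apply P_ext; [| congruence].
  rewrite ac; apply jm; [| congruence].
  rewrite r1c, r1d; crw jy; reflexivity.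
Qed.

Lemma spl_product (X Y : C) (E : SplExtOn X) (F : SplExtOn Y) :
  exists (G : SplExtOn (product L X Y)) (p : Hom (spl G) (spl E))
    (q : Hom (spl G) (spl F)),
    (hker p = proj1 L X Y /\ hker q = proj2 L X Y) /\
    forall (Z : C) (H : SplExtOn Z) (a : Hom (spl H) (spl E))
      (b : Hom (spl H) (spl F)),
    exists c : Hom (spl H) (spl G), (p ∘ c = a /\ q ∘ c = b) /\
      forall c' : Hom (spl H) (spl G), p ∘ c' = a -> q ∘ c' = b -> c' = c.
Proof.
assert (kerG : is_kernel (product_map L (inj E) (inj F))
                         (product_map L (prj E) (prj F))).
{ apply is_kernel_intro.
  - apply product_ext.
    + do 2 crw (proj1_product_map L _ _).
      crw (prj_inj E); rewrite comp_zero_l, comp_zero_r; reflexivity.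
    + do 2 crw (proj2_product_map L _ _).
      crw (prj_inj F); rewrite comp_zero_l, comp_zero_r; reflexivity.
  - intros Z g h e; apply product_ext.
    + apply (kernel_mono (inj_kernel E)).
      rewrite !comp_assoc, <- (proj1_product_map L (inj E) (inj F)).
      crw e; reflexivity.
    + apply (kernel_mono (inj_kernel F)).
      rewrite !comp_assoc, <- (proj2_product_map L (inj E) (inj F)).
      crw e; reflexivity.
  - intros Z g e.
    assert (e1 : prj E ∘ (proj1 L _ _ ∘ g) = zero_mor _ _).
    { rewrite comp_assoc, <- (proj1_product_map L (prj E) (prj F)).
      crw e; apply comp_zero_r. }
    assert (e2 : prj F ∘ (proj2 L _ _ ∘ g) = zero_mor _ _).
    { rewrite comp_assoc, <- (proj2_product_map L (prj E) (prj F)).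
      crw e; apply comp_zero_r. }
    destruct (kernel_factor (inj_kernel E) e1) as [k ek].
    destruct (kernel_factor (inj_kernel F) e2) as [l el].
    exists (pairing L k l); apply product_ext.
    + crw (proj1_product_map L _ _); rewrite proj1_pairing; exact ek.
    + crw (proj2_product_map L _ _); rewrite proj2_pairing; exact el. }
assert (psG : product_map L (prj E) (prj F) ∘ product_map L (sec E) (sec F)
              = id (product L (basis E) (basis F))).
{ apply product_ext; rewrite comp_id_r.
  - do 2 crw (proj1_product_map L _ _); crw (prj_sec E); apply comp_id_l.
  - do 2 crw (proj2_product_map L _ _); crw (prj_sec F); apply comp_id_l. }
set (G := Build_SplExtOn kerG psG); exists G.
exists (@spl_hom C _ _ G E (proj1 L _ _) (proj1 L _ _) (proj1 L _ _)
  (proj1_product_map L _ _) (proj1_product_map L _ _) (proj1_product_map L _ _)).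
exists (@spl_hom C _ _ G F (proj2 L _ _) (proj2 L _ _) (proj2 L _ _)
  (proj2_product_map L _ _) (proj2_product_map L _ _) (proj2_product_map L _ _)).
split; [split; reflexivity |].
intros Z H [ua va wa eia esa epa] [ub vb wb eib esb epb]; simpl in *.
assert (ec1 : pairing L va vb ∘ inj H = inj G ∘ pairing L ua ub).
{ simpl; apply product_ext.
  - crw (proj1_product_map L _ _).
    rewrite proj1_pairing, pairing_comp, proj1_pairing; exact eia.
  - crw (proj2_product_map L _ _).
    rewrite proj2_pairing, pairing_comp, proj2_pairing; exact eib. }
assert (ec2 : pairing L va vb ∘ sec H = sec G ∘ pairing L wa wb).
{ simpl; apply product_ext.
  - crw (proj1_product_map L _ _).
    rewrite proj1_pairing, pairing_comp, proj1_pairing; exact esa.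
  - crw (proj2_product_map L _ _).
    rewrite proj2_pairing, pairing_comp, proj2_pairing; exact esb. }
assert (ec3 : pairing L wa wb ∘ prj H = prj G ∘ pairing L va vb).
{ simpl; apply product_ext.
  - crw (proj1_product_map L _ _).
    rewrite proj1_pairing, pairing_comp, proj1_pairing; exact epa.
  - crw (proj2_product_map L _ _).
    rewrite proj2_pairing, pairing_comp, proj2_pairing; exact epb. }
exists (@spl_hom C _ _ H G _ _ _ ec1 ec2 ec3); split.
- split; apply spl_hom_ext; simpl; rewrite ?proj1_pairing, ?proj2_pairing;
    reflexivity.
- intros c' e1 e2; apply spl_hom_ext; simpl;
    apply product_ext; rewrite ?proj1_pairing, ?proj2_pairing.
  + exact (f_equal (@hker _ _ _) e1).
  + exact (f_equal (@hker _ _ _) e2).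
  + exact (f_equal (@htot _ _ _) e1).
  + exact (f_equal (@htot _ _ _) e2).
  + exact (f_equal (@hbase _ _ _) e1).
  + exact (f_equal (@hbase _ _ _) e2).
Qed.

(** The graph of f is a monomorphism, whatever f is.  Morphisms F -> E over f
are the same as morphisms F -> E0 x E over the graph, the component in E0 being
forced by genericity. *)
Lemma generic_normalizers_prefibration :
  has_generic_split_extensions C -> admits_normalizers L ->
  is_prefibration (K C).
Proof.
rewrite generic_iff, prefibration_iff; intros gen norm X' X f E.
destruct (gen X') as [E0 gen0].
destruct (spl_product E0 E) as [G [p [q [[ep eq] univG]]]].
assert (graph_mono : is_mono (pairing L (id X') f)).
{ intros Z g h e; destruct (pairing_comp_inj e) as [e1 _].
  rewrite !comp_id_l in e1; exact e1. }
destruct (normalizer_universal_lift G norm graph_mono)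
  as [E' [phi [ephi univ]]].
assert (eqphi : hker (q ∘ phi) = f).
{ simpl; rewrite eq, ephi; apply proj2_pairing. }
exists E', (q ∘ phi); split; [exact eqphi |]; intros F psi epsi.
destruct (gen0 F) as [b [eb uniqb]].
destruct (univG X' F b psi) as [c [[ec1 ec2] uniqc]].
destruct (univ F c) as [d [[ed1 ed2] uniqd]].
{ rewrite ephi; apply product_ext.
  - rewrite proj1_pairing, <- eb, <- ec1, <- ep; reflexivity.
  - rewrite proj2_pairing, <- eqphi, <- epsi, <- ec2, <- eq; reflexivity. }
exists d; split.
- split; [exact ed1 |]; rewrite <- comp_assoc, ed2; exact ec2.
- intros d' ed1' ed2'; apply uniqd; [exact ed1' |].
  apply uniqc; [| rewrite comp_assoc; exact ed2'].
  apply uniqb; simpl; rewrite ep, ephi, ed1', comp_id_r; apply proj1_pairing.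
Qed.

End Normalizers.

Theorem theorem3p1 (C : PointedCategory) (L : FiniteLimits C) :
  ((has_generic_split_extensions C /\ admits_normalizers L) <->
   has_generic_split_extensions (PointedArrow C)) /\
  (has_generic_split_extensions (PointedArrow C) <->
   is_prefibration (K C)).
Proof.
assert (ac : has_generic_split_extensions C /\ admits_normalizers L ->
             is_prefibration (K C)).
{ intros [gen norm]; exact (generic_normalizers_prefibration gen norm). }
assert (ca : is_prefibration (K C) ->
             has_generic_split_extensions C /\ admits_normalizers L).
{ intros pre; split; [exact (prefibration_generic pre) |].
  intros X' X f f_mono.
  destruct (prefibration_classifier L f pre) as [E [t0 cl]].
  exact (classifier_normalizer L cl f_mono). }
pose proof (@prefibration_arrow_generic C) as cb.
pose proof (arrow_generic_prefibration L) as bc.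
split; split; auto.
Qed.
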